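(* There is $\alpha_0>0$ such that for all $\alpha\ge\alpha_0$ the lattice $D_{16}^+\subseteq\mathbb{R}^{16}$ is a local minimum, and the lattice $E_8\perp E_8\subseteq\mathbb{R}^{16}$ is a saddle point, for the $f_\alpha$-potential energy on the manifold of rank $16$ lattices of point density $1$.
   Context: $D_{16}^+$ and $E_8\perp E_8$ are the two even unimodular lattices in dimension $16$ (up to isometry). $D_{16}^+$ is the lattice generated by $\{z\in\mathbb{Z}^{16}:\sum z_i\text{ even}\}$ and $\frac12(1,\dots,1)$; its vectors of squared norm $2$ form the root system $D_{16}$. $E_8\perp E_8$ is the orthogonal direct sum of two copies of the $E_8$ root lattice. For $\alpha>0$ let $f_\alpha(r)=e^{-\alpha r}$ and $\mathcal{E}(f_\alpha,L)=\sum_{x\in L\setminus\{0\}}e^{-\alpha\|x\|^2}$. The manifold of rank $n$ lattices of point density $1$ (one lattice point per unit volume) is parametrized by positive definite symmetric $n\times n$ matrices $Y$ of determinant $1$: with $L$ fixed (of density $1$), the energy function is $F_{\alpha,L}(Y)=\sum_{x\in L\setminus\{0\}}e^{-\alpha x^{\mathsf T}Yx}$, with $L$ itself corresponding to $Y=I_n$. $L$ is a critical point (local minimum, local maximum) for the $f_\alpha$-potential energy if $I_n$ is a critical point (local minimum, local maximum) of $F_{\alpha,L}$ on this manifold; a saddle point is a critical point which is neither a local minimum nor a local maximum. *)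

(* Defs.v *)
From mathcomp Require Import all_boot all_order all_algebra.
From mathcomp Require Import all_classical all_reals all_analysis.

Set Implicit Arguments.
Unset Strict Implicit.
Unset Printing Implicit Defensive.

Import Order.TTheory GRing.Theory Num.Theory.
Import numFieldNormedType.Exports.

Local Open Scope classical_set_scope.
Local Open Scope ring_scope.

Definition lattice_span (R : realType) (n : nat) (S : set 'cV[R]_n) :
    set 'cV[R]_n :=
  smallest (fun A : set 'cV[R]_n => zmod_closed (mem A)) S.

Definition Dn (R : realType) (n : nat) : set 'cV[R]_n :=
  [set map_mx (intr : int -> R) z | z in
    [set z : 'cV[int]_n | (2 %| (\sum_(i < n) z i 0)%R)%Z]].

Arguments Dn : clear implicits.

Definition Dn_plus (R : realType) (n : nat) : set 'cV[R]_n :=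
  lattice_span (Dn R n `|` [set const_mx 2^-1]).

Arguments Dn_plus : clear implicits.

(** Even coordinate system of the root system E_8: the 112 vectors
    (+-1, +-1, 0^6) in all positions and the 128 vectors (+-1/2)^8 with an
    even number of minus signs. *)
Definition E8_roots (R : realType) : set 'cV[R]_8 :=
  [set x | exists (i j : 'I_8) (s t : bool), i != j /\
     x = (-1) ^+ s *: delta_mx i 0 + (-1) ^+ t *: delta_mx j 0] `|`
  [set x | exists s : 'I_8 -> bool, ~~ odd (\sum_(i < 8) s i)%N /\
     x = \col_(i < 8) ((-1) ^+ s i / 2)].

Arguments E8_roots : clear implicits.

Definition E8 (R : realType) : set 'cV[R]_8 := lattice_span (E8_roots R).

Arguments E8 : clear implicits.

Definition orthosum (R : realType) (m n : nat)
    (L : set 'cV[R]_m) (M : set 'cV[R]_n) : set 'cV[R]_(m + n) :=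
  [set col_mx x y | x in L & y in M].

Definition unimodular_forms (R : realType) (n : nat) : set 'M[R]_n :=
  [set Y : 'M[R]_n | [/\ Y^T = Y,
     forall x : 'cV[R]_n, x != 0 -> 0 < (x^T *m Y *m x) 0 0
   & \det Y = 1]].

Arguments unimodular_forms : clear implicits.

Definition gauss (R : realType) (alpha r : R) : R := expR (- alpha * r).

(** The terms are nonnegative, so the unordered sum over [L \ {0}] is an
    [esum]; for [f = gauss alpha] with [0 < alpha], [L] a lattice and [Y]
    positive definite it is finite, so [fine] is applied to a real number. *)
Definition energy (R : realType) (n : nat) (f : R -> R) (L : set 'cV[R]_n)
    (Y : 'M[R]_n) : R :=
  fine (\esum_(x in L `\ 0) (f ((x^T *m Y *m x) 0 0))%:E).

(** [F] restricted to [M] is differentiable at [p] with zero differential,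
    expressed along the curves in [M] through [p] whose velocities are the
    tangent vectors of [M] at [p]. *)
Definition critical_on (R : realType) (V : normedModType R) (M : set V)
    (F : V -> R) (p : V) : Prop :=
  M p /\
  forall c : R -> V, c 0 = p -> (\forall t \near 0, M (c t)) ->
    derivable c 0 1 -> is_derive (0 : R) (1 : R) (F \o c) (0 : R).

Definition local_min_on (R : realType) (V : normedModType R) (M : set V)
    (F : V -> R) (p : V) : Prop :=
  M p /\ \forall q \near p, M q -> F p <= F q.

Definition local_max_on (R : realType) (V : normedModType R) (M : set V)
    (F : V -> R) (p : V) : Prop :=
  M p /\ \forall q \near p, M q -> F q <= F p.

Definition saddle_on (R : realType) (V : normedModType R) (M : set V)
    (F : V -> R) (p : V) : Prop :=
  [/\ critical_on M F p, ~ local_min_on M F p & ~ local_max_on M F p].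

(** The dimension is a successor because the library's normed module structure
    on matrices requires it. *)
Definition lattice_local_min (R : realType) (n : nat) (f : R -> R)
    (L : set 'cV[R]_n.+1) : Prop :=
  local_min_on (unimodular_forms R n.+1) (energy f L) 1%:M.

Definition lattice_saddle (R : realType) (n : nat) (f : R -> R)
    (L : set 'cV[R]_n.+1) : Prop :=
  saddle_on (unimodular_forms R n.+1) (energy f L) 1%:M.

(* Main.v *)
Require Import Defs.
From mathcomp Require Import all_boot all_order all_algebra fingroup perm.
From mathcomp Require Import all_classical all_reals all_analysis.
From mathcomp Require Import ring lra zify.

(** Write [B x = exp (- a |x|^2)] and [h x = x^T H x].  Both lattices are invariant under
    enough coordinate permutations and sign changes to make [sum B x * x x^T] a scalar
    matrix [moment a *: 1], so Taylor expansion of the exponential gives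
      energy (1 + H) = energy 1 - a * moment a * tr H + O(a^2 sum h^2 B),
    while [det (1 + H) = 1] forces [tr H = O(|H|^2)]: both lattices are critical.
    Their minimal norm is 2, so [moment a] is of order [exp (- 2 a)] and loses a factor
    [a] against the contribution [a^2 exp (- 2 a) h(y)^2 / 4] of a single root [y].
    For D16+ some root always sees [H], because D16 is perfect: the lattice is a local
    minimum.  For the sum of two copies of E8, a shear inside one block increases the
    energy; a shear mixing the two blocks is invisible to all roots to second order, and
    vectors of norm at least 4 contribute only [O(a^2 exp (- 7 a / 2))], so the negative
    term [- a * moment a * tr H] decreases the energy. *)

Set Implicit Arguments.
Unset Strict Implicit.
Unset Printing Implicit Defensive.

Import Order.TTheory GRing.Theory Num.Theory.
Import numFieldNormedType.Exports.

Local Open Scope classical_set_scope.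
Local Open Scope ring_scope.

(** * Unconditional sums of real families *)

Section RealSum.
Context {R : realType} {T : choiceType} (D : set T).
Implicit Types f g u v : T -> R.

Definition nnsum f : R := fine (\esum_(x in D) (f x)%:E).

Definition rsummable f : Prop := (\esum_(x in D) `|f x|%:E < +oo)%E.

(** Nonnegative sums are suprema in the extended reals, so a signed sum is taken as the difference
    of two nonnegative ones. It is meaningful for summable [f], because [fine] sends an infinite sum
    to 0. *)
Definition rsum f : R := nnsum (fun x => f x + `|f x|) - nnsum (fun x => `|f x|).

Lemma rsummable_le f g :
  (forall x, D x -> `|g x| <= f x) -> rsummable f -> rsummable g.
Proof.
move=> gf; apply: le_lt_trans; apply: le_esum => x Dx.
by rewrite lee_fin (le_trans (gf x Dx))// ler_norm.
Qed.

Lemma rsummable_norm f : rsummable f -> rsummable (fun x => `|f x|).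
Proof. by apply: le_lt_trans; apply: le_esum => x _; rewrite normr_id. Qed.

Lemma rsummableD f g : rsummable f -> rsummable g ->
  rsummable (fun x => f x + g x).
Proof.
move=> sf sg; apply: le_lt_trans (lte_add_pinfty sf sg).
rewrite -esumD => [|? _|? _]; rewrite ?lee_fin//.
by apply: le_esum => x _; rewrite -EFinD lee_fin ler_normD.
Qed.

Lemma nnsum_fin_num f : (forall x, D x -> 0 <= f x) -> rsummable f ->
  (\esum_(x in D) (f x)%:E)%R \is a fin_num.
Proof.
move=> f0 sf; rewrite ge0_fin_numE; last by apply: esum_ge0 => x Dx; rewrite lee_fin f0.
apply: le_lt_trans sf; apply: le_esum => x Dx; by rewrite lee_fin ler_norm.
Qed.

Lemma nnsumD f g : (forall x, D x -> 0 <= f x) -> (forall x, D x -> 0 <= g x) ->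
  rsummable f -> rsummable g ->
  nnsum (fun x => f x + g x) = nnsum f + nnsum g.
Proof.
move=> f0 g0 sf sg; rewrite /nnsum -fineD ?nnsum_fin_num// -esumD => [|x Dx|x Dx].
- by [].
- by rewrite lee_fin f0.
- by rewrite lee_fin g0.
Qed.

Lemma eq_nnsum f g : (forall x, D x -> f x = g x) -> nnsum f = nnsum g.
Proof. by move=> fg; congr fine; apply: eq_esum => x Dx; rewrite fg. Qed.

(** Cross-adding reduces the claim to additivity of [nnsum] on [(f + |f|) + v = u + |f|]. The
    freedom to choose [u] and [v] then yields linearity of [rsum]. *)
Lemma rsum_diff f u v : (forall x, D x -> 0 <= u x) -> (forall x, D x -> 0 <= v x) ->
  rsummable u -> rsummable v -> (forall x, D x -> f x = u x - v x) ->
  rsum f = nnsum u - nnsum v.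
Proof.
move=> u0 v0 su sv fE.
have sf : rsummable f.
  apply: (@rsummable_le (fun x => `|u x| + `|v x|)).
    by move=> x Dx; rewrite fE// ler_normB.
  by apply: rsummableD; apply: rsummable_norm.
have snf := rsummable_norm sf.
have f0 x : 0 <= f x + `|f x| by rewrite -(opprK (f x)) normrN addrC subr_ge0 ler_norm.
have : nnsum (fun x => f x + `|f x|) + nnsum v = nnsum u + nnsum (fun x => `|f x|).
  rewrite -!nnsumD//; last exact: rsummableD.
  by apply: eq_nnsum => x Dx; rewrite fE//; ring.
rewrite /rsum; lra.
Qed.

Lemma rsum_nonneg f : (forall x, D x -> 0 <= f x) -> rsummable f -> rsum f = nnsum f.
Proof.
move=> f0 sf; rewrite (@rsum_diff f f (fun=> 0))//.
- suff -> : nnsum (fun=> 0) = 0 by rewrite subr0.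
  by rewrite /nnsum esum1.
- by rewrite /rsummable esum1// => x _; rewrite normr0.
- by move=> x _; rewrite subr0.
Qed.

Lemma eq_rsum f g : (forall x, D x -> f x = g x) -> rsum f = rsum g.
Proof. by move=> fg; congr (_ - _); apply: eq_nnsum => x Dx; rewrite fg. Qed.

Lemma rsumD f g : rsummable f -> rsummable g ->
  rsum (fun x => f x + g x) = rsum f + rsum g.
Proof.
move=> sf sg.
have snf := rsummable_norm sf; have sng := rsummable_norm sg.
have p0 (h : T -> R) x : 0 <= h x + `|h x|.
  by rewrite -(opprK (h x)) normrN addrC subr_ge0 ler_norm.
rewrite (@rsum_diff _ (fun x => (f x + `|f x|) + (g x + `|g x|))
  (fun x => `|f x| + `|g x|)).
- rewrite (@nnsumD (fun x => f x + `|f x|) (fun x => g x + `|g x|))//;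
    try exact: rsummableD.
  by rewrite (@nnsumD (fun x => `|f x|) (fun x => `|g x|))// /rsum; ring.
- by move=> x _; rewrite addr_ge0.
- by move=> x _; rewrite addr_ge0.
- by apply: rsummableD; exact: rsummableD.
- exact: rsummableD.
- by move=> x _; ring.
Qed.

Lemma esum_EFinZ c f : 0 <= c ->
  (\esum_(x in D) (c * f x)%:E = c%:E * \esum_(x in D) (f x)%:E)%E.
Proof.
move=> c0; rewrite /esum -ereal_supZl//; last first.
  by apply/set0P; exists 0%E; exists set0; [exact: fsets_set0|rewrite fsbig_set0].
congr ereal_sup; apply/seteqP; split=> [_ [A [fA AD] <-]|_ [_ [A [fA AD] <-] <-]].
  exists (\sum_(x \in A) (f x)%:E)%R; first by exists A.
  by rewrite !fsumEFin// -EFinM !fsbig_finite//= mulr_sumr.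
by exists A => //; rewrite !fsumEFin// -EFinM !fsbig_finite//= mulr_sumr.
Qed.

Lemma nnsumZ c f : 0 <= c -> (forall x, D x -> 0 <= f x) -> rsummable f ->
  nnsum (fun x => c * f x) = c * nnsum f.
Proof.
by move=> c0 f0 sf; rewrite /nnsum esum_EFinZ// fineM ?nnsum_fin_num.
Qed.

Lemma rsummableZ c f : rsummable f -> rsummable (fun x => c * f x).
Proof.
move=> sf; rewrite /rsummable; under eq_esum do rewrite normrM.
by rewrite esum_EFinZ// lte_mul_pinfty// lee_fin.
Qed.

Lemma rsumZ c f : rsummable f -> rsum (fun x => c * f x) = c * rsum f.
Proof.
move=> sf.
have snf := rsummable_norm sf.
have p0 x : 0 <= f x + `|f x|.
  by rewrite -(opprK (f x)) normrN addrC subr_ge0 ler_norm.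
have sp := rsummableD sf snf.
case: (leP 0 c) => c0.
  rewrite (@rsum_diff _ (fun x => c * (f x + `|f x|)) (fun x => c * `|f x|)).
  - by rewrite !nnsumZ//; rewrite /rsum; ring.
  - by move=> x _; rewrite mulr_ge0.
  - by move=> x _; rewrite mulr_ge0.
  - exact: rsummableZ.
  - exact: rsummableZ.
  - by move=> x _; ring.
have c0' : 0 <= - c by rewrite oppr_ge0 ltW.
rewrite (@rsum_diff _ (fun x => - c * `|f x|) (fun x => - c * (f x + `|f x|))).
- by rewrite !nnsumZ//; rewrite /rsum; ring.
- by move=> x _; rewrite mulr_ge0.
- by move=> x _; rewrite mulr_ge0.
- exact: rsummableZ.
- exact: rsummableZ.
- by move=> x _; ring.
Qed.

Lemma rsum_ge0 f : (forall x, D x -> 0 <= f x) -> rsummable f -> 0 <= rsum f.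
Proof.
move=> f0 sf; rewrite rsum_nonneg// fine_ge0// esum_ge0//.
Qed.

Lemma ler_rsum f g : rsummable f -> rsummable g ->
  (forall x, D x -> f x <= g x) -> rsum f <= rsum g.
Proof.
move=> sf sg fg.
have sd : rsummable (fun x => g x + (-1) * f x) by apply/rsummableD/rsummableZ.
have : 0 <= rsum (fun x => g x + (-1) * f x).
  by apply: rsum_ge0 => // x Dx; rewrite mulN1r subr_ge0 fg.
by rewrite rsumD ?rsumZ//; [lra|exact: rsummableZ].
Qed.

Lemma rsum_ge_term f y : D y -> (forall x, D x -> 0 <= f x) -> rsummable f ->
  f y <= rsum f.
Proof.
move=> Dy f0 sf; rewrite rsum_nonneg// -[f y]/(fine (f y)%:E) fine_le ?nnsum_fin_num//.
apply: esum_ge; exists [set y]; last by rewrite fsbig_set1.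
by split; [exact: finite_set1|move=> _ ->].
Qed.

Lemma rsummable_indic y a : rsummable (fun x => (x == y)%:R * a).
Proof.
apply: (@le_lt_trans _ _ (\esum_(x in [set y]) `|a|%:E)); last first.
  by rewrite esum_set1 ?ltry// lee_fin.
rewrite esum_mkcond [leRHS]esum_mkcond; apply: le_esum => x _.
case: ifP => _; case: ifPn; rewrite ?lee_fin//.
- rewrite in_setE => /= ->; by rewrite eqxx mul1r.
- by move/negP => h; case: eqP => [e|]; [case: h; rewrite in_setE/= e|rewrite mul0r normr0].
Qed.

(** The bump at [y] lets [energy_lower] credit an extra gain to a single root inside a comparison
    made term by term. *)
Lemma rsum_indic y a : D y -> 0 <= a -> a <= rsum (fun x => (x == y)%:R * a).
Proof.
move=> Dy a0; rewrite -[leLHS]mul1r -[X in X * a]/(true%:R) -(eqxx y).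
apply: (@rsum_ge_term (fun x => (x == y)%:R * a)) => //.
  by move=> x _; rewrite mulr_ge0.
exact: rsummable_indic.
Qed.

Lemma rsummable_sum (I : Type) (r : seq I) (F : I -> T -> R) :
  (forall i, rsummable (F i)) -> rsummable (fun x => \sum_(i <- r) F i x).
Proof.
move=> sF; elim: r => [|i r IH].
  by rewrite /rsummable esum1// => x _; rewrite big_nil normr0.
rewrite (_ : (fun x => _) = fun x => F i x + \sum_(i <- r) F i x); last first.
  by apply/funext => x; rewrite big_cons.
exact: rsummableD.
Qed.

Lemma rsum_sum (I : Type) (r : seq I) (F : I -> T -> R) :
  (forall i, rsummable (F i)) ->
  rsum (fun x => \sum_(i <- r) F i x) = \sum_(i <- r) rsum (F i).
Proof.
move=> sF; elim: r => [|i r IH].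
  rewrite big_nil (@eq_rsum _ (fun=> 0)); last by move=> x _; rewrite big_nil.
  by rewrite rsum_nonneg// /nnsum ?/rsummable esum1// => x _; rewrite normr0.
rewrite big_cons -IH -rsumD//; last exact: rsummable_sum.
by apply: eq_rsum => x _; rewrite big_cons.
Qed.

Lemma rsum_involutive f (s : T -> T) : (forall x, D x -> D (s x)) ->
  (forall x, s (s x) = x) -> rsum (fun x => f (s x)) = rsum f.
Proof.
move=> sD sK.
have bij : set_bij D D s.
  split => //; last by move=> x Dx; exists (s x) => //; exact: sD.
  by move=> x y _ _ /(congr1 s); rewrite !sK.
by rewrite /rsum /nnsum [in RHS](reindex_esum _ _ _ _ bij)
  [X in _ = _ - fine X](reindex_esum _ _ _ _ bij).
Qed.

End RealSum.

(** * Gaussian sums over half-integral vectors *)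

Section Theta.
Context {R : realType}.

(** With truncated subtraction the exponent is [|j - N|], so this sums [q^|k|] over the integers
    [|k| <= N]. The induction peels off the two extreme terms. *)
Lemma two_sided_geometric_sum (q : R) N :
  (1 - q) * (\sum_(j < N.*2.+1) q ^+ ((j - N) + (N - j))) = 1 + q - 2 * q ^+ N.+1.
Proof.
elim: N => [|N IH].
  by rewrite big_ord_recl big_ord0 /= expr0 expr1; ring.
rewrite doubleS big_ord_recl big_ord_recr /= /bump /=.
rewrite (eq_bigr (fun j : 'I_N.*2.+1 => q ^+ ((j - N) + (N - j)))); last first.
  by move=> j _; congr (_ ^+ _); rewrite /bump /=; lia.
rewrite (_ : (0 - N.+1 + (N.+1 - 0) = N.+1)%N); last by lia.
rewrite (_ : _ + _ = N.+1)%N; last by lia.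
rewrite !mulrDr IH !exprS; ring.
Qed.

Lemma sum_uniq_sub_le (T : eqType) (s t : seq T) (F : T -> R) :
  (forall x, 0 <= F x) -> uniq s -> {subset s <= t} ->
  \sum_(x <- s) F x <= \sum_(x <- t) F x.
Proof.
move=> F0; elim: s t => [|x s IH] t /=.
  by move=> _ _; rewrite big_nil sumr_ge0.
move=> /andP[xs us] st.
have xt : x \in t by apply: st; rewrite mem_head.
rewrite (perm_big _ (perm_to_rem xt)) !big_cons lerD2l; apply: IH => // y ys.
have := st y; rewrite inE ys orbT => /(_ isT).
rewrite (perm_mem (perm_to_rem xt)) inE => /orP[/eqP yx|//].
by rewrite -yx ys in xs.
Qed.

(** The ambient group for every lattice below: a Gaussian sum over it factors into one-dimensional
    sums. *)
Definition half_int n : set 'cV[R]_n :=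
  [set x | exists w : 'cV[int]_n, forall i, x i 0 = (w i 0)%:~R / 2].

Definition normsq n (x : 'cV[R]_n) : R := \sum_i x i 0 ^+ 2.

Lemma normsq_ge0 n (x : 'cV[R]_n) : 0 <= normsq x.
Proof. by apply: sumr_ge0 => i _; exact: sqr_ge0. Qed.

(** A finite set of half-integral vectors lies in a cube with doubled coordinates in [[-N, N]]. The
    sum over the cube is a product of [n] sums, each at most [(1 + q) / (1 - q)], since
    [exp (- b k^2 / 4) <= q^|k|] for integral [k]; the bound [M] is independent of [N]. *)
Lemma rsummable_gauss n (b : R) : 0 < b ->
  rsummable (half_int (n:=n)) (fun x => expR (- b * normsq x)).
Proof.
move=> b0.
pose q := expR (- b / 4).
have q1 : q < 1 by rewrite expR_lt1; lra.
have q0 : 0 < q by exact: expR_gt0.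
pose M := (2 / (1 - q)) ^+ n.
apply: (@le_lt_trans _ _ M%:E); last by rewrite ltry.
apply: ge_ereal_sup => _ [A [fA AD] <-].
rewrite fsumEFin// lee_fin fsbig_finite//=.
set s := (X in \sum_(i <- X) _).
have sD x : x \in s -> half_int x.
  by move=> xs; apply: AD; move: xs; rewrite /s in_fset_set// in_setE.
pose wit (x : 'cV[R]_n) : 'cV[int]_n := \col_i Num.floor (2 * x i 0).
have witE x i : half_int x -> x i 0 = (wit x i 0)%:~R / 2.
  move=> [w wE]; rewrite mxE wE.
  by rewrite (_ : 2 * (_ / 2) = (w i 0)%:~R) ?intrKfloor//; field.
pose N := \max_(x <- s) \max_(i < n) absz (wit x i 0%R).
pose g (f : {ffun 'I_n -> 'I_N.*2.+1}) : 'cV[R]_n := \col_i (((f i)%:R - N%:R) / 2).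
pose e := expR (R := R).
have us : uniq s by rewrite /s; exact: finmap.fset_uniq.
have sub : {subset s <= [seq g f | f : {ffun 'I_n -> 'I_N.*2.+1}]}.
  move=> x xs.
  have bnd i : (absz (wit x i 0%R) <= N)%N.
    apply: (@leq_trans (\max_(i < n) absz (wit x i 0%R))).
      exact: (leq_bigmax (F := fun i => absz (wit x i 0%R)) i).
    exact: (leq_bigmax_seq (F := fun x => \max_(i < n) absz (wit x i 0%R)) x xs isT).
  apply/mapP; exists [ffun i => inord (absz (wit x i 0%R + N%:Z))].
    by rewrite mem_enum.
  apply/colP => i; rewrite mxE ffunE (witE x i (sD _ xs)).
  have := bnd i; move: (wit x i 0) => z zN.
  rewrite inordK; last by rewrite -addnn; lia.
  congr (_ / 2).
  have zN0 : 0 <= z + N%:Z by lia.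
  by rewrite natr_absz ger0_norm// intrD -pmulrn; ring.
under eq_bigr do rewrite ger0_norm ?expR_ge0//.
apply: le_trans (sum_uniq_sub_le _ us sub) _; first by move=> ?; exact: expR_ge0.
rewrite big_map big_enum /=.
pose G (j : 'I_N.*2.+1) := q ^+ ((j - N) + (N - j)).
apply: (@le_trans _ _ (\sum_(f : {ffun 'I_n -> 'I_N.*2.+1}) \prod_i G (f i))).
  apply: ler_sum => f _.
  rewrite /normsq mulr_sumr expR_sum; apply: ler_prod => i _.
  rewrite expR_ge0 /=/G mxE /q -expRM_natl ler_expR.
  set m := (_ + _)%N.
  have -> : (((f i)%:R - N%:R) / 2 : R) ^+ 2 = (m ^ 2)%:R / 4.
    rewrite (_ : (_ / 2) ^+ 2 = ((f i)%:R - N%:R) ^+ 2 / 4); last by field.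
    congr (_ / 4); rewrite natrX /m; case: (leqP (f i) N) => [le|/ltnW le].
      by rewrite (_ : (f i - N = 0)%N) ?add0n ?natrB//; [ring|lia].
    by rewrite (_ : (N - f i = 0)%N) ?addn0 ?natrB//; lia.
  have : (m%:R : R) <= (m ^ 2)%:R by rewrite ler_nat; case: (m) => // k; rewrite expnS; lia.
  move: (m%:R : R) ((m ^ 2)%:R : R) => u v uv; nra.
rewrite -(bigA_distr_bigA (fun _ => G)) /= prodr_const card_ord.
apply: lerXn2r; rewrite ?nnegrE ?divr_ge0//; try lra.
  by apply: sumr_ge0 => j _; rewrite exprn_ge0// ltW.
rewrite ler_pdivlMr ?subr_gt0// mulrC two_sided_geometric_sum.
by have := exprn_ge0 N.+1 (ltW q0); move: (q ^+ N.+1) => Q; lra.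
Qed.

End Theta.

(** * Exponential, quadratic form and determinant estimates *)

Section ExpBounds.
Context {R : realType}.

(** Square the tangent bound [1 + t/2 <= exp (t/2)], whose left side is nonnegative here. This is
    the origin of the factor 1/4 in [energy_lower]. *)
Lemma expR_ge_quad (t : R) : - 1 <= t -> 1 + t + t ^+ 2 / 4 <= expR t.
Proof.
move=> t1; have := expR_ge1Dx (t / 2).
rewrite (_ : expR t = expR (t / 2) ^+ 2); last first.
  by rewrite -expRM_natl; congr expR; field.
move: (expR _) => e h; nra.
Qed.

(** From [1 - t <= exp (- t)] one gets [exp t <= 1 + t + t (exp t - 1)]. The last product is at most
    [t^2 exp t] for [t >= 0] and at most [t^2] for [t < 0]. *)
Lemma expR_le_quad (t : R) : expR t <= 1 + t + t ^+ 2 * expR `|t|.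
Proof.
have h1 := expR_ge1Dx (- t); have h2 := expR_ge1Dx t; have e0 := expR_gt0 t.
have h3 : expR t - 1 <= t * expR t.
  have : expR t * (1 - t) <= 1.
    by rewrite -[leRHS](expRxMexpNx_1 t) ler_wpM2l ?expR_ge0.
  lra.
case: (leP 0 t) => t0.
  by rewrite ger0_norm//; move: (expR t) h2 h3 e0 => e h2 h3 e0; nra.
rewrite ltr0_norm//.
have e1 : 1 <= expR (- t) by apply: le_trans h1; lra.
have : t * (expR t - 1) <= t ^+ 2.
  by move: (expR t) h2 h3 e0 => e h2 h3 e0; nra.
have : t ^+ 2 <= t ^+ 2 * expR (- t) by rewrite ler_peMr// sqr_ge0.
set u := t ^+ 2 * expR (- t); move: u (expR t) h2 h3 e0 => u e h2 h3 e0; nra.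
Qed.

(** Half of the exponent absorbs [r^2]: [expR_ge_quad] at [b r / 2] gives
    [(b r / 2)^2 / 4 <= exp (b r / 2)]. *)
Lemma sqr_expR_bound (b r : R) : 0 < b -> 0 <= r ->
  r ^+ 2 * expR (- b * r) <= 16 / b ^+ 2 * expR (- (b / 2) * r).
Proof.
move=> b0 r0; rewrite (_ : - b * r = - (b / 2) * r + - (b / 2 * r)); last by field.
rewrite expRD mulrCA [leRHS]mulrC ler_wpM2l ?expR_ge0//.
rewrite expRN ler_pdivrMr ?expR_gt0//.
have br : 0 <= b / 2 * r by rewrite mulr_ge0// divr_ge0// ltW.
have h : (b / 2 * r) ^+ 2 / 4 <= expR (b / 2 * r).
  apply: le_trans (expR_ge_quad _); lra.
rewrite (_ : r ^+ 2 = 16 / b ^+ 2 * ((b / 2 * r) ^+ 2 / 4)); last by field; lra.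
by rewrite ler_wpM2l// divr_ge0// sqr_ge0.
Qed.

End ExpBounds.

(** * Entrywise estimates for quadratic forms and for determinants near the identity *)

Section MatrixBounds.
Context {R : realType}.

Definition qform n (H : 'M[R]_n) (x : 'cV[R]_n) : R := (x^T *m H *m x) 0 0.

Lemma qformE n (H : 'M[R]_n) x :
  qform H x = \sum_i \sum_j H i j * (x i 0 * x j 0).
Proof.
rewrite /qform mxE exchange_big /=; apply: eq_bigr => j _.
rewrite mxE mulr_suml; apply: eq_bigr => i _; rewrite !mxE; ring.
Qed.

Lemma qform1 n (x : 'cV[R]_n) : qform 1%:M x = normsq x.
Proof. by rewrite /qform mulmx1 mxE; apply: eq_bigr => i _; rewrite mxE. Qed.

Lemma qformD n (H K : 'M[R]_n) x : qform (H + K) x = qform H x + qform K x.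
Proof. by rewrite /qform mulmxDr mulmxDl mxE. Qed.

Lemma qform_bound n (H : 'M[R]_n) (e : R) x : (forall i j, `|H i j| <= e) ->
  `|qform H x| <= n%:R * e * normsq x.
Proof.
move=> He.
case: n H x He => [|n] H x He; first by rewrite qformE big_ord0 normr0 !mul0r.
have e0 : 0 <= e by apply: le_trans (He 0 0).
rewrite qformE; apply: le_trans (ler_norm_sum _ _ _) _.
apply: (@le_trans _ _ (\sum_i \sum_j e * ((x i 0 ^+ 2 + x j 0 ^+ 2) / 2))).
  apply: ler_sum => i _; apply: le_trans (ler_norm_sum _ _ _) _.
  apply: ler_sum => j _; rewrite normrM ler_pM// ler_norml.
  have := sqr_ge0 (x i 0 - x j 0); have := sqr_ge0 (x i 0 + x j 0).
  by move=> h1 h2; apply/andP; split; lra.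
under eq_bigr => i _ do rewrite -mulr_sumr -mulr_suml big_split /= sumr_const card_ord.
rewrite -mulr_sumr -mulr_suml big_split /= sumr_const card_ord sumrMnl.
by rewrite -/(normsq x) -mulr_natl; lra.
Qed.

(** The point is that [C] depends on the index list alone. Adding a factor [1 + a i] creates the new
    error [a i * (P - 1)], where [P] is the old product and [|P - 1|] is at most
    [(C + size r) e]. *)
Lemma prod_1D_bound (I : Type) (r : seq I) : exists2 C : R, 0 <= C &
  forall (a : I -> R) (e : R), e <= 1 -> (forall i, `|a i| <= e) ->
  `|\prod_(i <- r) (1 + a i) - 1 - \sum_(i <- r) a i| <= C * e ^+ 2.
Proof.
elim: r => [|i r [C C0 IH]].
  exists 0 => // a e _ _; by rewrite !big_nil subrr subr0 normr0 mul0r.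
exists (C + (C + (size r)%:R)); first by rewrite !addr_ge0.
move=> a e e1 ae; rewrite !big_cons.
have {}IH := IH a e e1 ae.
have e0 : 0 <= e by apply: le_trans (ae i).
have S : `|\sum_(i <- r) a i| <= (size r)%:R * e.
  apply: le_trans (ler_norm_sum _ _ _) _.
  apply: le_trans (ler_sum _ (fun i _ => ae i)) _.
  by rewrite big_const_seq count_predT iter_addr_0 mulr_natl.
move: (\prod_(j <- r) _) (\sum_(j <- r) _) IH S => P S IH hS.
rewrite (_ : _ - _ = (P - 1 - S) + a i * ((P - 1 - S) + S)); last by ring.
apply: le_trans (ler_normD _ _) _.
rewrite mulrDl lerD// normrM.
apply: (@le_trans _ _ (e * ((C + (size r)%:R) * e))); last by rewrite le_eqVlt; apply/orP; left; apply/eqP; ring.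
apply: ler_pM => //.
apply: le_trans (ler_normD _ _) _; rewrite mulrDl lerD//.
apply: le_trans IH _; by rewrite ler_wpM2l// expr2 ler_piMl.
Qed.

(** If [i] is moved, so is [s i], by injectivity. Hence every other Leibniz term than that of the
    identity contains two off-diagonal entries. *)
Lemma perm_neq1_moves2 n (s : 'S_n) : s != 1%g ->
  exists i j, [/\ i != j, s i != i & s j != j].
Proof.
move=> s1.
have [i si] : exists i, s i != i.
  apply/existsP; apply: contraNT s1; rewrite negb_exists => /forallP h.
  by apply/eqP/permP => i; rewrite perm1; apply/eqP; have := h i; rewrite negbK.
by exists i, (s i); rewrite eq_sym si (inj_eq perm_inj).
Qed.

(** In the Leibniz formula the identity contributes the diagonal product, handled by
    [prod_1D_bound]. Any other permutation gives two off-diagonal factors of size at most [e], the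
    remaining factors being at most 2. *)
Lemma det_1D_bound n : exists2 C : R, 0 <= C &
  forall (H : 'M[R]_n) (e : R), e <= 1 -> (forall i j, `|H i j| <= e) ->
  `|\det (1%:M + H) - 1 - \tr H| <= C * e ^+ 2.
Proof.
have [C C0 hC] := prod_1D_bound (index_enum 'I_n).
exists (C + \sum_(s : 'S_n | s != 1%g) 2 ^+ n).
  by rewrite addr_ge0// sumr_ge0// => s _; rewrite exprn_ge0.
move=> H e e1 He; rewrite /determinant (bigD1 1%g) //= odd_perm1 expr0 mul1r.
rewrite (eq_bigr (fun i => 1 + H i i)); last first.
  by move=> i _; rewrite perm1 !mxE eqxx.
set P := \prod_i _; set Q := (X in P + X).
rewrite (_ : P + Q - 1 - \tr H = (P - 1 - \tr H) + Q); last by ring.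
apply: le_trans (ler_normD _ _) _; rewrite mulrDl lerD//.
  exact: (hC (fun i => H i i)).
rewrite mulr_suml; apply: le_trans (ler_norm_sum _ _ _) _.
apply: ler_sum => s s1; rewrite normrM normrX normrN1 expr1n mul1r normr_prod.
have [i [j [ij si sj]]] := perm_neq1_moves2 s1.
have e0 : 0 <= e by apply: le_trans (He i i).
rewrite (bigD1 i)//= (bigD1 j)/=; last by rewrite eq_sym.
have off k : s k != k -> `|(1%:M + H) k (s k)| <= e.
  by move=> sk; rewrite !mxE eq_sym (negbTE sk) add0r.
rewrite mulrA mulrC; apply: ler_pM; rewrite ?mulr_ge0 ?prodr_ge0//.
  apply: (@le_trans _ _ (\prod_(k | (k != i) && (k != j)) 2)).
    apply: ler_prod => k _; rewrite normr_ge0 /= !mxE.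
    apply: le_trans (ler_normD _ _) _.
    have := He k (s k); case: (_ == _); rewrite ?normr1 ?normr0; lra.
  by rewrite prodr_const ler_eXn2l ?ltr1n// (leq_trans (max_card _))// card_ord.
by rewrite expr2 ler_pM ?off.
Qed.

(** Traceless matrices are the tangent space of [det = 1] at the identity, so on this hypersurface
    the trace is a second-order quantity. *)
Lemma tr_bound_det1 n : exists2 C : R, 0 <= C &
  forall (H : 'M[R]_n) (e : R), e <= 1 -> (forall i j, `|H i j| <= e) ->
  \det (1%:M + H) = 1 -> `|\tr H| <= C * e ^+ 2.
Proof.
have [C C0 hC] := det_1D_bound n; exists C => // H e e1 He d1.
by have := hC H e e1 He; rewrite d1 subrr sub0r normrN.
Qed.

End MatrixBounds.

(** * Energy of a lattice with signed coordinate symmetries *)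

Section Lattice.
Context {R : realType}.

Definition lattice_sym m (L : set 'cV[R]_m) (s : 'cV[R]_m -> 'cV[R]_m) : Prop :=
  [/\ forall x, L x -> L (s x), forall x, s (s x) = x
    & forall x, normsq (s x) = normsq x].

(** [sym_diag] makes all diagonal second moments equal and [sym_off] makes the off-diagonal ones
    vanish; this forces the second moment matrix of the Gaussian weights to be scalar. *)
Record sym_lattice m (L : set 'cV[R]_m) : Prop := SymLattice {
  sym_half_int : L `<=` half_int (n:=m);
  sym_min_norm : forall x, L x -> x != 0 -> 2 <= normsq x;
  sym_diag : forall i j, exists2 s, lattice_sym L s & forall x, s x i 0 = x j 0;
  sym_off : forall i j, i != j -> exists2 s, lattice_sym L s &
    forall x, s x i 0 * s x j 0 = - (x i 0 * x j 0) }.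

Lemma normsq_eq0 m (x : 'cV[R]_m) : normsq x = 0 -> x = 0.
Proof.
move=> /eqP; rewrite psumr_eq0 => [/allP h|i _]; last exact: sqr_ge0.
apply/colP => i; rewrite mxE; apply/eqP; rewrite -sqrf_eq0.
by apply: h; rewrite mem_index_enum.
Qed.

Lemma sqr_coord_le m (x : 'cV[R]_m) i : x i 0 ^+ 2 <= normsq x.
Proof.
rewrite /normsq (bigD1 i)//= lerDl sumr_ge0// => j _; exact: sqr_ge0.
Qed.

Context (n : nat) (L : set 'cV[R]_n.+1) (HL : sym_lattice L).
Let D := L `\ 0.

Lemma rsummable_sub (T : choiceType) (A B : set T) (f : T -> R) :
  A `<=` B -> rsummable B f -> rsummable A f.
Proof.
move=> AB; apply: le_lt_trans; rewrite esum_mkcond [leRHS]esum_mkcond.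
apply: le_esum => x _; case: ifP => [|_]; last by case: ifP; rewrite lee_fin.
by rewrite !in_setE => /AB h; rewrite mem_set.
Qed.

(** The common summability criterion: [sqr_expR_bound] trades the polynomial factor for half of the
    exponent, and [L] sits inside [half_int]. *)
Lemma rsummable_poly_gauss (b C : R) (f : 'cV[R]_n.+1 -> R) : 0 < b ->
  (forall x, D x -> `|f x| <= C * ((1 + normsq x ^+ 2) * expR (- b * normsq x))) ->
  rsummable D f.
Proof.
move=> b0 hf.
apply: (@rsummable_le _ _ _
  (fun x => `|C| * (1 + 16 / b ^+ 2) * expR (- (b / 2) * normsq x))).
  move=> x Dx; apply: le_trans (hf x Dx) _; rewrite -mulrA.
  apply: le_trans (_ : _ <= `|C| * ((1 + normsq x ^+ 2) * expR (- b * normsq x))) _.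
    by rewrite ler_wpM2r ?ler_norm// mulr_ge0 ?expR_ge0// addr_ge0// exprn_ge0// normsq_ge0.
  rewrite ler_wpM2l// (mulrDl 1 (normsq x ^+ 2)) (mulrDl 1 (16 / _)) !mul1r lerD ?sqr_expR_bound ?normsq_ge0//.
  by rewrite ler_expR; have := normsq_ge0 x; nra.
apply: (rsummableZ _ (f := fun x => expR (- (b / 2) * normsq x))).
apply: (@rsummable_sub _ _ (half_int (n:=n.+1))).
  by move=> x [Lx _]; exact: sym_half_int Lx.
by apply: rsummable_gauss; rewrite divr_gt0.
Qed.

Definition wt (a : R) (x : 'cV[R]_n.+1) : R := expR (- a * normsq x).

Lemma wt_ge0 a x : 0 <= wt a x. Proof. exact: expR_ge0. Qed.

Lemma energyE a (Y : 'M[R]_n.+1) :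
  energy (gauss a) L Y = nnsum D (fun x => expR (- a * qform Y x)).
Proof. by []. Qed.

Lemma normsq_quad_le (r : R) : r <= 1 + r ^+ 2.
Proof. by have := sqr_ge0 (r - 1); nra. Qed.

Lemma rsummable_wt a : 0 < a -> rsummable D (wt a).
Proof.
move=> a0; apply: (@rsummable_poly_gauss a 1) => // x _.
by rewrite ger0_norm ?wt_ge0// mul1r ler_peMl ?expR_ge0// lerDl sqr_ge0.
Qed.

Lemma rsummable_wt_coord a i j : 0 < a ->
  rsummable D (fun x => wt a x * (x i 0 * x j 0)).
Proof.
move=> a0; apply: (@rsummable_poly_gauss a 1) => // x _.
rewrite normrM ger0_norm ?wt_ge0// mul1r mulrC ler_wpM2r ?wt_ge0//.
apply: le_trans (normsq_quad_le _).
have := sqr_coord_le x i; have := sqr_coord_le x j.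
have := sqr_ge0 (x i 0 - x j 0); have := sqr_ge0 (x i 0 + x j 0).
by move=> h1 h2 h3 h4; rewrite ler_norml; apply/andP; split; lra.
Qed.

Lemma rsummable_wt_qform a (H : 'M[R]_n.+1) : 0 < a ->
  rsummable D (fun x => wt a x * qform H x).
Proof.
move=> a0.
rewrite (_ : (fun x => _) = fun x => \sum_i \sum_j H i j * (wt a x * (x i 0 * x j 0))).
  apply: rsummable_sum => i; apply: rsummable_sum => j.
  by apply/rsummableZ/rsummable_wt_coord.
apply/funext => x; rewrite qformE mulr_sumr; apply: eq_bigr => i _.
by rewrite mulr_sumr; apply: eq_bigr => j _; ring.
Qed.

Definition moment a : R := rsum D (fun x => wt a x * x 0 0 ^+ 2).

Lemma sym_D s : lattice_sym L s -> forall x, D x -> D (s x).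
Proof.
move=> [sL _ sN] x [Lx x0]; split; first exact: sL.
by move=> /= s0; apply: x0; apply: normsq_eq0; rewrite -sN s0 /normsq big1// => i _; rewrite mxE expr0n.
Qed.

(** Reindexing by a symmetry carries coordinate [i] to coordinate [0] on the diagonal, and shows
    [S = - S] off the diagonal. *)
Lemma second_moment a i j : 0 < a ->
  rsum D (fun x => wt a x * (x i 0 * x j 0)) = moment a *+ (i == j).
Proof.
move=> a0; case: eqVneq => [<-|ij].
  have [s ss si] := sym_diag HL i 0; rewrite mulr1n /moment.
  have [_ sK sN] := ss.
  rewrite -[LHS](rsum_involutive _ (sym_D ss) sK); apply: eq_rsum => x _.
  by rewrite si /wt sN expr2.
have [s ss sij] := sym_off HL ij; rewrite mulr0n.
have [_ sK sN] := ss.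
set S := rsum _ _; suff : S = (-1) * S by lra.
rewrite -{1}[S](rsum_involutive _ (sym_D ss) sK) -rsumZ; last exact: rsummable_wt_coord.
by apply: eq_rsum => x _; rewrite sij /wt sN; ring.
Qed.

(** The first-order term of the energy therefore sees [H] only through its trace. *)
Lemma rsum_wt_qform a (H : 'M[R]_n.+1) : 0 < a ->
  rsum D (fun x => wt a x * qform H x) = moment a * \tr H.
Proof.
move=> a0.
transitivity (rsum D (fun x => \sum_i \sum_j H i j * (wt a x * (x i 0 * x j 0)))).
  apply: eq_rsum => x _; rewrite qformE mulr_sumr; apply: eq_bigr => i _.
  by rewrite mulr_sumr; apply: eq_bigr => j _; ring.
rewrite rsum_sum; last first.
  by move=> i; apply: rsummable_sum => j; apply/rsummableZ/rsummable_wt_coord.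
rewrite mulr_sumr; apply: eq_bigr => i _; rewrite rsum_sum; last first.
  by move=> j; apply/rsummableZ/rsummable_wt_coord.
rewrite (bigD1 i)//= big1 ?addr0 => [|j ji].
  rewrite rsumZ; last exact: rsummable_wt_coord.
  by rewrite second_moment// eqxx mulr1n mulrC.
rewrite rsumZ; last exact: rsummable_wt_coord.
by rewrite second_moment// eq_sym (negbTE ji) mulr0n mulr0.
Qed.

Lemma rsummable_energy a (H : 'M[R]_n.+1) : 0 < a ->
  (forall x, `|qform H x| <= normsq x / 8) ->
  rsummable D (fun x => expR (- a * qform (1%:M + H) x)).
Proof.
move=> a0 hH; apply: (@rsummable_poly_gauss (7 / 8 * a) 1); first lra.
move=> x _; rewrite ger0_norm ?expR_ge0// mul1r.
apply: (@le_trans _ _ (expR (- (7 / 8 * a) * normsq x))).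
  rewrite ler_expR qformD qform1.
  have := hH x; rewrite ler_norml => /andP[h1 h2]; have := normsq_ge0 x; nra.
by rewrite ler_peMl ?expR_ge0// lerDl sqr_ge0.
Qed.

Lemma energy_rsum a (H : 'M[R]_n.+1) : 0 < a ->
  (forall x, `|qform H x| <= normsq x / 8) ->
  energy (gauss a) L (1%:M + H) = rsum D (fun x => expR (- a * qform (1%:M + H) x)).
Proof.
move=> a0 hH; rewrite rsum_nonneg; last exact: rsummable_energy.
  by rewrite energyE.
by move=> x _; exact: expR_ge0.
Qed.

Lemma energy1_rsum a : 0 < a -> energy (gauss a) L 1%:M = rsum D (wt a).
Proof.
move=> a0; rewrite rsum_nonneg; last exact: rsummable_wt.
  by rewrite energyE; apply: eq_nnsum => x _; rewrite qform1.
by move=> x _; exact: wt_ge0.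
Qed.

(** Every vector contributes at least the tangent line [1 - a h] times its weight. The root [y]
    contributes the quadratic term as well, [a |h y| <= 1] being what [expR_ge_quad] requires. *)
Lemma energy_lower a (H : 'M[R]_n.+1) y : 0 < a ->
  (forall x, `|qform H x| <= normsq x / 8) ->
  L y -> normsq y = 2 -> a * `|qform H y| <= 1 ->
  energy (gauss a) L 1%:M - a * (moment a * \tr H)
    + a ^+ 2 / 4 * expR (- a * 2) * qform H y ^+ 2
  <= energy (gauss a) L (1%:M + H).
Proof.
move=> a0 hH Ly y2 ay.
have s1 := rsummable_wt a0; have s2 := rsummable_wt_qform H a0.
have s3 := rsummable_energy a0 hH.
have s4 : rsummable D (fun x => - a * (wt a x * qform H x)) by exact: rsummableZ.
have s5 : rsummable D (fun x => wt a x + - a * (wt a x * qform H x)) by exact: rsummableD.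
set c := _ / 4 * _ * _.
have c0 : 0 <= c by rewrite mulr_ge0 ?sqr_ge0// mulr_ge0 ?expR_ge0// divr_ge0 ?sqr_ge0.
have Dy : D y.
  by split => //= y0; move: y2; rewrite y0 /normsq big1 => [|i _]; [lra|rewrite mxE expr0n].
rewrite energy1_rsum// energy_rsum//.
have := ler_rsum (rsummableD s5 (rsummable_indic D y c)) s3.
rewrite rsumD//; last exact: rsummable_indic.
rewrite rsumD// rsumZ// rsum_wt_qform// => h.
have := rsum_indic Dy c0 => hc.
suff : rsum D (wt a) + - a * (moment a * \tr H) + rsum D (fun x => (x == y)%:R * c)
   <= rsum D (fun x => expR (- a * qform (1%:M + H) x)) by lra.
apply: h => x Dx.
rewrite qformD qform1 mulrDr expRD -/(wt a x).
case: (eqVneq x y) => [->|_]; last first.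
  rewrite mul0r addr0; have := expR_ge1Dx (- a * qform H x); have := wt_ge0 a x.
  by move: (wt a x) (qform H x) (expR _) => w q e; nra.
rewrite mul1r /c /wt y2.
have : 1 + - a * qform H y + (- a * qform H y) ^+ 2 / 4 <= expR (- a * qform H y).
  apply: expR_ge_quad; move: ay; rewrite -{1}(gtr0_norm a0) -normrM ler_norml; lra.
have := expR_ge0 (- a * 2).
by move: (expR (- a * 2)) (qform H y) (expR _) => w q e; nra.
Qed.

(** Here [g] is a summable majorant of the second-order remainder in [expR_le_quad]; the callers
    choose it. *)
Lemma energy_upper a (H : 'M[R]_n.+1) (g : 'cV[R]_n.+1 -> R) : 0 < a ->
  (forall x, `|qform H x| <= normsq x / 8) -> rsummable D g ->
  (forall x, D x -> a ^+ 2 * qform H x ^+ 2 * expR (a * `|qform H x|) * wt a x <= g x) ->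
  energy (gauss a) L (1%:M + H)
  <= energy (gauss a) L 1%:M - a * (moment a * \tr H) + rsum D g.
Proof.
move=> a0 hH sg hg.
have s1 := rsummable_wt a0; have s2 := rsummable_wt_qform H a0.
have s3 := rsummable_energy a0 hH.
have s4 : rsummable D (fun x => - a * (wt a x * qform H x)) by exact: rsummableZ.
have s5 : rsummable D (fun x => wt a x + - a * (wt a x * qform H x)) by exact: rsummableD.
rewrite energy1_rsum// energy_rsum//.
have := ler_rsum s3 (rsummableD s5 sg).
rewrite !rsumD// rsumZ// rsum_wt_qform// => h.
rewrite -mulNr; apply: h => x Dx.
apply: le_trans (lerD (lexx _) (hg x Dx)).
rewrite qformD qform1 mulrDr expRD -/(wt a x).
have := expR_le_quad (- a * qform H x); rewrite normrM normrN (gtr0_norm a0).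
have := wt_ge0 a x.
by move: (wt a x) (qform H x) (expR (_ * `|_|)) (expR _) => w q e e'; nra.
Qed.

Lemma moment_ge0 a : 0 < a -> 0 <= moment a.
Proof.
move=> a0; apply: rsum_ge0 => [x _|]; first by rewrite mulr_ge0 ?wt_ge0 ?sqr_ge0.
by have := rsummable_wt_coord 0 0 a0; under eq_fun do rewrite -expr2.
Qed.

Lemma moment_ge a y : 0 < a -> L y -> normsq y = 2 ->
  expR (- a * 2) * y 0 0 ^+ 2 <= moment a.
Proof.
move=> a0 Ly y2.
rewrite (_ : expR _ = wt a y); last by rewrite /wt y2.
apply: (rsum_ge_term (f := fun x => wt a x * x 0 0 ^+ 2)) => [|x _|].
- by split => //= y0; move: y2; rewrite y0 /normsq big1 => [|i _]; [lra|rewrite mxE expr0n].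
- by rewrite mulr_ge0 ?wt_ge0 ?sqr_ge0.
by have := rsummable_wt_coord 0 0 a0; under eq_fun do rewrite -expr2.
Qed.

(** Compare with the parameter 1: for [|x|^2 >= 2], [(a - 1) (|x|^2 - 2) >= 0] says that
    [exp (- a |x|^2)] is at most [exp (2 - 2 a) exp (- |x|^2)]. *)
Lemma moment_le a : 1 <= a ->
  moment a <= expR (- a * 2) * (expR 2 * moment 1).
Proof.
move=> a1; have a0 : 0 < a by lra.
have s1 : rsummable D (fun x => wt 1 x * x 0 0 ^+ 2).
  by have := rsummable_wt_coord 0 0 ltr01; under eq_fun do rewrite -expr2.
have s2 : rsummable D (fun x => wt a x * x 0 0 ^+ 2).
  by have := rsummable_wt_coord 0 0 a0; under eq_fun do rewrite -expr2.
rewrite mulrA -rsumZ//; apply: ler_rsum => //; first exact: rsummableZ.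
move=> x [Lx /eqP x0]; rewrite mulrA ler_wpM2r ?sqr_ge0// /wt -!expRD ler_expR.
have := sym_min_norm HL Lx x0; nra.
Qed.

End Lattice.

(** * The lattices D_n^+ and E_8 *)

Section Span.
Context {R : realType} {n : nat}.
Implicit Types (A S : set 'cV[R]_n) (x y : 'cV[R]_n).

Lemma zmod_closed_set A :
  A 0 -> (forall x y, A x -> A y -> A (x - y)) -> zmod_closed (mem A).
Proof.
move=> A0 AB; split; first by rewrite in_setE.
by move=> x y; rewrite !in_setE; exact: AB.
Qed.

Lemma span0 S : lattice_span S 0.
Proof. by move=> A [[A0 _] _]; move: A0; rewrite in_setE. Qed.

Lemma spanB S x y : lattice_span S x -> lattice_span S y -> lattice_span S (x - y).
Proof.
move=> Sx Sy A HA; have := HA => -[[_ AB] _].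
have := AB x y; rewrite !in_setE; apply; [exact: Sx|exact: Sy].
Qed.

Lemma spanN S x : lattice_span S x -> lattice_span S (- x).
Proof. by move=> Sx; rewrite -sub0r; apply: spanB => //; exact: span0. Qed.

Lemma spanD S x y : lattice_span S x -> lattice_span S y -> lattice_span S (x + y).
Proof. by move=> Sx Sy; rewrite -[y]opprK; apply: spanB => //; exact: spanN. Qed.

Lemma span_sum S (I : Type) (r : seq I) (F : I -> 'cV[R]_n) :
  (forall i, lattice_span S (F i)) -> lattice_span S (\sum_(i <- r) F i).
Proof.
move=> SF; elim: r => [|i r IH]; first by rewrite big_nil; exact: span0.
by rewrite big_cons; exact: spanD.
Qed.

Lemma spanMz S x (k : int) : lattice_span S x -> lattice_span S (k%:~R *: x).
Proof.
move=> Sx; have Snat (m : nat) : lattice_span S (m%:R *: x).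
  elim: m => [|m IH]; first by rewrite scale0r; exact: span0.
  by rewrite -natr1 scalerDl scale1r; exact: spanD.
case: k => m; first exact: Snat.
by rewrite NegzE mulrNz scaleNr; apply: spanN; exact: Snat.
Qed.

Lemma span_gen S x : S x -> lattice_span S x.
Proof. by move=> Sx A [_ SA]; exact: SA. Qed.

End Span.

(** * Coordinates, minimal norms and symmetries of the two lattices *)

Section EvenLattice.
Context {R : realType}.

(** An explicit description shared by [Dn_plus] and [E8]. Allowing every integer [k], not only 0 and
    1, makes closure under subtraction immediate. *)
Definition even_lattice n : set 'cV[R]_n :=
  [set x | exists (k : int) (z : 'cV[int]_n), (2 %| \sum_i z i 0)%Z /\
    forall i, x i 0 = (z i 0)%:~R + k%:~R / 2].

Lemma even_lattice_zmod n : zmod_closed (mem (even_lattice (n:=n))).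
Proof.
apply: zmod_closed_set.
  exists 0, 0; split; first by rewrite big1 ?dvdz0// => i _; rewrite mxE.
  by move=> i; rewrite !mxE mul0r addr0.
move=> x y [k [z [ze xE]]] [k' [z' [ze' yE]]].
exists (k - k'), (z - z'); split.
  under eq_bigr do rewrite !mxE.
  by rewrite big_split /= sumrN rpredB.
by move=> i; rewrite !mxE xE yE !intrB; ring.
Qed.

Lemma even_lattice_signed_pair n (i j : 'I_n) (s t : bool) :
  even_lattice ((-1) ^+ s *: delta_mx i 0 + (-1) ^+ t *: delta_mx j 0).
Proof.
exists 0, ((-1) ^+ s *: delta_mx i 0 + (-1) ^+ t *: delta_mx j 0); split.
  under eq_bigr do rewrite !mxE eqxx !andbT.
  rewrite big_split /= -!mulr_sumr.
  rewrite (bigD1 i)//= big1 => [|l li]; last by rewrite (negbTE li).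
  rewrite (bigD1 j)//= big1 => [|l lj]; last by rewrite (negbTE lj).
  by rewrite !eqxx; case: s t => -[].
move=> l; rewrite !mxE mul0r addr0 intrD !intrM !rmorphXn /= !mulrNz.
by congr (_ * _ + _ * _); case: (_ && _).
Qed.

Lemma Dn_plusE n : Dn_plus R n = even_lattice (n:=n).
Proof.
apply/seteqP; split.
  apply: smallest_sub; first exact: even_lattice_zmod.
  move=> x [[z /= ze <-]|/= ->].
    by exists 0, z; split=> // i; rewrite mxE mul0r addr0.
  exists 1, 0; split; first by rewrite big1 ?dvdz0// => i _; rewrite mxE.
  by move=> i; rewrite !mxE; ring.
move=> x [k [z [ze xE]]].
have -> : x = map_mx intr z + k%:~R *: const_mx 2^-1.
  by apply/colP => i; rewrite !mxE xE.
apply: spanD; first by apply: span_gen; left; exists z.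
by apply: spanMz; apply: span_gen; right.
Qed.

Lemma E8E : E8 R = even_lattice (n:=8).
Proof.
apply/seteqP; split.
  apply: smallest_sub; first exact: even_lattice_zmod.
  move=> x [[i [j [s [t [ij ->]]]]]|[s [se ->]]].
    exact: even_lattice_signed_pair.
  (* A sign change at [i] subtracts 1 from the coordinate 1/2, so an even number of them subtracts
     an integral vector of even sum. *)
  exists 1, (\col_i - (s i : nat)%:Z); split.
    under eq_bigr do rewrite mxE.
    rewrite sumrN rpredN -(big_morph Posz PoszD (erefl _)).
    by move: se; move: (\sum_(i < 8) _)%N => m; rewrite dvdzE /= dvdn2.
  by move=> i; rewrite !mxE; case: (s i); rewrite /= ?expr0 ?expr1; field.
move=> x [k [z [/dvdzP[m zm] xE]]].
pose e (i : 'I_8) : 'cV[R]_8 := delta_mx i 0.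
have Sroot i j (s t : bool) : i != j ->
    E8 R ((-1) ^+ s *: e i + (-1) ^+ t *: e j).
  by move=> ij; apply: span_gen; left; exists i, j, s, t.
(* The coordinates of [z] sum to [2 m]. Moving them all to the last position leaves [2 m] times the
   last basis vector, and twice that basis vector is a sum of two roots. *)
have -> : x = \sum_i (z i 0)%:~R *: (e i - e ord_max) +
     (m%:~R *: ((e ord_max + e 0) + (e ord_max - e 0)) + k%:~R *: const_mx 2^-1).
  have -> : \sum_i (z i 0)%:~R *: (e i - e ord_max) =
      map_mx intr z - (m * 2)%:~R *: e ord_max.
    under eq_bigr do rewrite scalerBr.
    rewrite sumrB -scaler_suml -zm rmorph_sum /=; congr (_ - _).
    rewrite [RHS]matrix_sum_delta; apply: eq_bigr => i _.
    by rewrite big_ord1 mxE.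
  apply/colP => i; rewrite !mxE xE intrM.
  by field.
apply: spanD.
  apply: span_sum => i; apply: spanMz.
  have [->|im] := eqVneq i ord_max; first by rewrite subrr; exact: span0.
  by have := Sroot _ _ false true im; rewrite expr0 expr1 scale1r scaleN1r.
apply: spanD.
  apply: spanMz; apply: spanD.
    by have := Sroot ord_max 0 false false isT; rewrite !expr0 !scale1r.
  by have := Sroot ord_max 0 false true isT; rewrite expr0 expr1 scale1r scaleN1r.
apply: spanMz; apply: span_gen; right; exists (fun=> false); split.
  by rewrite big1.
by apply/colP => i; rewrite !mxE expr0 mul1r.
Qed.

Lemma even_lattice_half_int n : even_lattice (n:=n) `<=` half_int (n:=n).
Proof.
move=> x [k [z [_ xE]]]; exists (\col_i (2 * z i 0 + k)) => i.
by rewrite xE mxE intrD intrM; field.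
Qed.

(** For even [k] the vector is integral and its norm has the parity of its coordinate sum, which is
    even because [n] is; a positive even integer is at least 2. For odd [k] each coordinate is at
    least 1/2 in absolute value, so the norm is at least [n / 4]. *)
Lemma even_lattice_min_norm n (x : 'cV[R]_n) : ~~ odd n -> (8 <= n)%N ->
  even_lattice x -> x != 0 -> 2 <= normsq x.
Proof.
move=> on n8 [k [z [ze xE]]] x0.
have [|ko] := boolP (2 %| k)%Z.
  move=> /dvdzP[q kq].
  pose w i := z i 0 + q.
  have xw i : x i 0 = (w i)%:~R by rewrite xE kq intrM /w intrD; field.
  have wE : normsq x = (\sum_i w i ^+ 2)%:~R.
    by rewrite rmorph_sum; apply: eq_bigr => i _; rewrite xw rmorphXn.
  have w2 : (2 %| \sum_i w i ^+ 2)%Z.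
    have -> : \sum_i w i ^+ 2 = \sum_i (w i ^+ 2 - w i) + \sum_i w i.
      by rewrite -big_split /=; apply: eq_bigr => i _; rewrite subrK.
    apply: rpredD.
      apply: rpred_sum => i _; move: (w i) => v.
      rewrite (_ : v ^+ 2 - v = v * (v - 1)); last by ring.
      have [ve|vo] := boolP (2 %| v)%Z; first exact: dvdz_mulr.
      by apply: dvdz_mull; lia.
    rewrite big_split /= rpredD// sumr_const card_ord.
    by rewrite -[q *+ n]mulr_natr; apply: dvdz_mull; rewrite natz dvdzE /= dvdn2.
  have : 0 < normsq x.
    rewrite lt_def normsq_ge0 andbT; apply: contraNneq x0 => h.
    by rewrite (normsq_eq0 h).
  rewrite wE ltr0z (_ : 2 = 2%:~R)// ler_int => w0.
  by move: w2 w0; move: (\sum_i _) => s; lia.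
apply: (@le_trans _ _ (n%:R / 4)).
  by rewrite ler_pdivlMr// -natrM ler_nat.
rewrite (_ : n%:R / 4 = \sum_(i < n) 4^-1); last by rewrite sumr_const card_ord mulr_natl.
apply: ler_sum => i _; rewrite xE.
have -> : (z i 0)%:~R + k%:~R / 2 = (2 * z i 0 + k)%:~R / 2 :> R.
  by rewrite intrD intrM; field.
have : 1 <= (2 * z i 0 + k) ^+ 2.
  have : 2 * z i 0 + k != 0 by move: (z i 0) ko => u; lia.
  move: (2 * _ + _) => u u0; have : 0 < u ^+ 2 by rewrite exprn_even_gt0.
  by move: (u ^+ 2) => v; lia.
by rewrite -(ler_int R) rmorphXn /=; set v : R := (2 * _ + _)%:~R; lra.
Qed.

Definition swap_coord n (i j : 'I_n) (x : 'cV[R]_n) : 'cV[R]_n := row_perm (tperm i j) x.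
Definition flip2 n (i j : 'I_n) (x : 'cV[R]_n) : 'cV[R]_n :=
  \col_l (if (l == i) || (l == j) then - x l 0 else x l 0).

Lemma swap_coordK n (i j : 'I_n) : involutive (swap_coord i j).
Proof. by move=> x; apply/colP => l; rewrite !mxE tpermK. Qed.

Lemma normsq_swap_coord n (i j : 'I_n) x : normsq (swap_coord i j x) = normsq x.
Proof.
rewrite /normsq [RHS](reindex_inj (@perm_inj _ (tperm i j))).
by apply: eq_bigr => l _; rewrite mxE.
Qed.

Lemma even_lattice_swap n (i j : 'I_n) x :
  even_lattice x -> even_lattice (swap_coord i j x).
Proof.
move=> [k [z [ze xE]]]; exists k, (row_perm (tperm i j) z); split.
  rewrite (_ : \sum_i _ = \sum_i z i 0)//.
  rewrite [RHS](reindex_inj (@perm_inj _ (tperm i j))).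
  by apply: eq_bigr => l _; rewrite mxE.
by move=> l; rewrite !mxE xE.
Qed.

Lemma flip2K n (i j : 'I_n) : involutive (flip2 i j).
Proof. by move=> x; apply/colP => l; rewrite !mxE; case: (_ || _); rewrite ?opprK. Qed.

Lemma normsq_flip2 n (i j : 'I_n) x : normsq (flip2 i j x) = normsq x.
Proof. by apply: eq_bigr => l _; rewrite mxE; case: ifP; rewrite ?sqrrN. Qed.

Lemma even_lattice_flip2 n (i j : 'I_n) x : i != j ->
  even_lattice x -> even_lattice (flip2 i j x).
Proof.
move=> ij [k [z [ze xE]]].
(* Negating [z + k/2] replaces [z] by [- z - k]; doing so at two positions changes the sum by an
   even number. *)
exists k, (\col_l (if (l == i) || (l == j) then - z l 0 - k else z l 0)); split.
  move: ze; rewrite (bigD1 i)//= (bigD1 j) 1?eq_sym//=.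
  rewrite [X in _ -> (_ %| X)%Z](bigD1 i)//= [X in _ -> (_ %| _ + X)%Z](bigD1 j) 1?eq_sym//=.
  set z' : 'cV[int]_n := \col_l _.
  have -> : \sum_(l < n | (l != i) && (l != j)) z' l 0 =
      \sum_(l < n | (l != i) && (l != j)) z l 0.
    by apply: eq_bigr => l /andP[/negbTE li /negbTE lj]; rewrite mxE li lj.
  rewrite !mxE !eqxx orbT /=.
  by move: (\sum_(_ < _ | _) _) => s; lia.
move=> l; rewrite !mxE xE; case: ifP => // _.
by rewrite intrB intrN; field.
Qed.

Lemma exists_third n (i j : 'I_n) : (2 < n)%N -> exists k : 'I_n, (k != i) && (k != j).
Proof.
move=> n2; apply/existsP; apply: contraLR n2; rewrite negb_exists -leqNgt => /forallP h.
rewrite -[n in (n <= _)%N]card_ord -(cardC (pred2 i j)).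
rewrite [X in (_ + X)%N]eq_card0 ?addn0 => [|k]; last first.
  by rewrite !inE negb_or; apply/negbTE/h.
by rewrite card2; case: (_ == _).
Qed.

Lemma Dn_plus_sym n : ~~ odd n -> (8 <= n)%N -> sym_lattice (Dn_plus R n).
Proof.
move=> on n8; rewrite Dn_plusE; split.
- exact: even_lattice_half_int.
- by move=> x; exact: even_lattice_min_norm.
- move=> i j; exists (swap_coord i j); last by move=> x; rewrite mxE tpermL.
  split; [exact: even_lattice_swap|exact: swap_coordK|exact: normsq_swap_coord].
(* Signs may only be flipped in pairs, so the partner of [i] is a third index [k], leaving
   coordinate [j] untouched. *)
move=> i j ij; have [|k /andP[ki kj]] := @exists_third _ i j; first exact: leq_trans n8.
exists (flip2 i k).
  split; [|exact: flip2K|exact: normsq_flip2].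
  by move=> x; apply: even_lattice_flip2; rewrite eq_sym.
by move=> x; rewrite !mxE eqxx /= eq_sym (negbTE ij) eq_sym (negbTE kj) /= mulNr.
Qed.

Lemma normsq_col_mx m n (x : 'cV[R]_m) (y : 'cV[R]_n) :
  normsq (col_mx x y) = normsq x + normsq y.
Proof.
rewrite /normsq big_split_ord /=.
by congr (_ + _); apply: eq_bigr => i _; rewrite ?col_mxEu ?col_mxEd.
Qed.

Definition block_map m (f g : 'cV[R]_m -> 'cV[R]_m) (x : 'cV[R]_(m + m)) : 'cV[R]_(m + m) :=
  col_mx (f (usubmx x)) (g (dsubmx x)).
Definition block_swap m (x : 'cV[R]_(m + m)) : 'cV[R]_(m + m) :=
  col_mx (dsubmx x) (usubmx x).

Lemma orthosumP m (L : set 'cV[R]_m) (x : 'cV[R]_(m + m)) :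
  orthosum L L x <-> L (usubmx x) /\ L (dsubmx x).
Proof.
split=> [[u Lu [d Ld <-]]|[Lu Ld]]; first by rewrite col_mxKu col_mxKd.
by exists (usubmx x) => //; exists (dsubmx x) => //; rewrite vsubmxK.
Qed.

Lemma normsq_block m (x : 'cV[R]_(m + m)) : normsq x = normsq (usubmx x) + normsq (dsubmx x).
Proof. by rewrite -normsq_col_mx vsubmxK. Qed.

Lemma block_map_sym m (L : set 'cV[R]_m) f g : lattice_sym L f -> lattice_sym L g ->
  lattice_sym (orthosum L L) (block_map f g).
Proof.
move=> [Lf fK nf] [Lg gK ng]; split.
- by move=> x /orthosumP[hu hd]; apply/orthosumP; rewrite col_mxKu col_mxKd; split; auto.
- by move=> x; rewrite /block_map col_mxKu col_mxKd fK gK vsubmxK.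
- by move=> x; rewrite [LHS]normsq_block [RHS]normsq_block col_mxKu col_mxKd nf ng.
Qed.

(** Applying the same [f] to both blocks makes it commute with the exchange, so the composite is
    again an involution. *)
Lemma block_swap_sym m (L : set 'cV[R]_m) f : lattice_sym L f ->
  lattice_sym (orthosum L L) (fun x => block_map f f (block_swap x)).
Proof.
move=> sf; have [h1 h2 h3] := block_map_sym sf sf; have [_ fK _] := sf; split.
- move=> x /orthosumP[hu hd]; apply: h1.
  by apply/orthosumP; rewrite col_mxKu col_mxKd.
- by move=> x; rewrite /block_map /block_swap !(col_mxKu, col_mxKd) !fK vsubmxK.
- by move=> x; rewrite h3 [LHS]normsq_block [RHS]normsq_block col_mxKu col_mxKd addrC.
Qed.

(** Exchanging the blocks identifies their diagonal moments; negating one block kills the mixed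
    moments. Within a block the symmetries of [L] are used. *)
Lemma orthosum_sym m (L : set 'cV[R]_m) : L 0 -> (forall x, L x -> L (- x)) ->
  (forall i j, lattice_sym L (swap_coord i j)) ->
  sym_lattice L -> sym_lattice (orthosum L L).
Proof.
move=> L0 LN swapL HL.
have idL : lattice_sym L id by [].
have oppL : lattice_sym L -%R.
  by split=> // [x|x]; [exact: opprK|apply: eq_bigr => l _; rewrite mxE sqrrN].
split.
- move=> x /orthosumP[/(sym_half_int HL)[w wE] /(sym_half_int HL)[v vE]].
  exists (col_mx w v) => i; case: (split_ordP i) => i' ->.
    by rewrite col_mxEu -wE mxE.
  by rewrite col_mxEd -vE mxE.
- move=> x /orthosumP[Lu Ld] x0; rewrite normsq_block.
  have [u0|u0] := eqVneq (usubmx x) 0.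
    have d0 : dsubmx x != 0.
      by apply: contraNneq x0 => d0; rewrite -[x]vsubmxK u0 d0 col_mx0.
    by rewrite ler_wpDl ?normsq_ge0// (sym_min_norm HL).
  by rewrite ler_wpDr ?normsq_ge0// (sym_min_norm HL).
- move=> i j; case: (split_ordP i) => i' ->; case: (split_ordP j) => j' ->.
  + exists (block_map (swap_coord i' j') id); first exact: block_map_sym.
    by move=> x; rewrite col_mxEu !mxE tpermL.
  + exists (fun x => block_map (swap_coord i' j') (swap_coord i' j') (block_swap x)).
      exact: block_swap_sym.
    by move=> x; rewrite col_mxEu col_mxKu !mxE tpermL.
  + exists (fun x => block_map (swap_coord i' j') (swap_coord i' j') (block_swap x)).
      exact: block_swap_sym.
    by move=> x; rewrite col_mxEd col_mxKd !mxE tpermL.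
  + exists (block_map id (swap_coord i' j')); first exact: block_map_sym.
    by move=> x; rewrite col_mxEd !mxE tpermL.
move=> i j; case: (split_ordP i) => i' ->; case: (split_ordP j) => j' ->.
- rewrite (inj_eq (@lshift_inj _ _)) => /(sym_off HL)[s ss sE].
  exists (block_map s id); first exact: block_map_sym.
  by move=> x; rewrite !col_mxEu sE !mxE.
- move=> _; exists (block_map -%R id); first exact: block_map_sym.
  by move=> x; rewrite col_mxEu col_mxEd !mxE mulNr.
- move=> _; exists (block_map -%R id); first exact: block_map_sym.
  by move=> x; rewrite col_mxEu col_mxEd !mxE mulrN.
rewrite (inj_eq (@rshift_inj _ _)) => /(sym_off HL)[s ss sE].
exists (block_map id s); first exact: block_map_sym.
by move=> x; rewrite !col_mxEd sE !mxE.
Qed.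

Lemma E8_swap_sym i j : lattice_sym (E8 R) (swap_coord i j).
Proof.
rewrite E8E; split; [exact: even_lattice_swap|exact: swap_coordK|exact: normsq_swap_coord].
Qed.

Lemma E8_sym : sym_lattice (E8 R).
Proof. by rewrite E8E -Dn_plusE; exact: Dn_plus_sym. Qed.

Lemma E8E8_sym : sym_lattice (orthosum (E8 R) (E8 R)).
Proof.
apply: orthosum_sym; [exact: span0|exact: spanN|exact: E8_swap_sym|exact: E8_sym].
Qed.

End EvenLattice.

(** * Critical points *)

Section Critical.
Context {R : realType} {n : nat}.
Implicit Types (L : set 'cV[R]_n.+1) (H Y : 'M[R]_n.+1).

Lemma qform_small H (e : R) : (forall i j, `|H i j| <= e) -> n.+1%:R * e <= 8^-1 ->
  forall x, `|qform H x| <= normsq x / 8.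
Proof.
move=> He ne x; apply: le_trans (qform_bound _ He) _.
by rewrite mulrC ler_wpM2l ?normsq_ge0.
Qed.

(** [energy_lower] and [energy_upper] enclose the difference. The two summands of [K] come from the
    linear term, where [tr H = O(e^2)], and from the Taylor remainder. *)
Lemma energy_quadratic_bound L (a : R) y : sym_lattice L -> 0 < a -> L y -> normsq y = 2 ->
  exists K d : R, [/\ 0 <= K, 0 < d & forall H (e : R), e <= d ->
    (forall i j, `|H i j| <= e) -> \det (1%:M + H) = 1 ->
    `|energy (gauss a) L (1%:M + H) - energy (gauss a) L 1%:M| <= K * e ^+ 2].
Proof.
move=> HL a0 Ly y2; have [C C0 trC] := @tr_bound_det1 R n.+1.
pose m := moment L a; have m0 : 0 <= m := moment_ge0 HL a0.
(* Since [a |h x| <= a |x|^2 / 8], the exponential in the remainder costs only one eighth of the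
   Gaussian. *)
pose g (x : 'cV[R]_n.+1) := normsq x ^+ 2 * expR (- (7 / 8 * a) * normsq x) : R.
have g0 x : 0 <= g x by rewrite /g mulr_ge0 ?expR_ge0 ?sqr_ge0.
have sg : rsummable (L `\ 0) g.
  apply: (@rsummable_poly_gauss _ _ _ HL (7 / 8 * a) 1); first lra.
  move=> x _; rewrite ger0_norm// mul1r /g.
  by rewrite ler_wpM2r ?expR_ge0// lerDr.
have S0 : 0 <= rsum (L `\ 0) g.
  by apply: rsum_ge0.
pose K := a * (m * C) + a ^+ 2 * n.+1%:R ^+ 2 * rsum (L `\ 0) g.
have n1 : 1 <= n.+1%:R :> R by rewrite ler1n.
(* As [|h x| <= (n+1) e |x|^2], the second bound gives [|h x| <= |x|^2 / 8] and the third gives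
   [a |h y| <= 1] at a vector of norm 2. *)
exists K, (Num.min 1 (Num.min (8^-1 / n.+1%:R) (2^-1 / a / n.+1%:R))); split.
- by rewrite addr_ge0// !mulr_ge0// ?sqr_ge0// ltW.
- by rewrite !lt_min ltr01 !divr_gt0 ?invr_gt0.
move=> H e; rewrite !le_min => /and3P[e1 e8 ea] He dH.
have e0 : 0 <= e by apply: le_trans (He 0 0).
have ne8 : n.+1%:R * e <= 8^-1 by rewrite mulrC -ler_pdivlMr.
have hH := qform_small He ne8.
have tr := trC H e e1 He dH.
have trm : a * (m * `|\tr H|) <= a * (m * C) * e ^+ 2.
  by rewrite -!mulrA !ler_wpM2l// ltW.
have ay : a * `|qform H y| <= 1.
  have := qform_bound y He; rewrite y2 => h.
  have : e * n.+1%:R * a <= 2^-1 by rewrite -!ler_pdivlMr// mulrAC.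
  have := ler_wpM2l (ltW a0) h; lra.
have lo := energy_lower HL a0 hH Ly y2 ay; rewrite -/m in lo.
have lo0 : 0 <= a ^+ 2 / 4 * expR (- a * 2) * qform H y ^+ 2.
  by rewrite mulr_ge0 ?sqr_ge0// mulr_ge0 ?expR_ge0// divr_ge0 ?sqr_ge0.
have hg x : (L `\ 0) x -> a ^+ 2 * qform H x ^+ 2 * expR (a * `|qform H x|) * wt a x
    <= a ^+ 2 * n.+1%:R ^+ 2 * e ^+ 2 * g x.
  move=> _; have N0 := normsq_ge0 x.
  rewrite -[leLHS]mulrA; apply: (@le_trans _ _
    (a ^+ 2 * qform H x ^+ 2 * expR (- (7 / 8 * a) * normsq x))).
    apply: ler_wpM2l; first by rewrite mulr_ge0 ?sqr_ge0.
    rewrite /wt -expRD ler_expR.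
    have := ler_wpM2l (ltW a0) (hH x); lra.
  rewrite /g mulrA; apply: ler_wpM2r; first exact: expR_ge0.
  rewrite (_ : _ * normsq x ^+ 2 = a ^+ 2 * (n.+1%:R * e * normsq x) ^+ 2); last by ring.
  apply: ler_wpM2l; first exact: sqr_ge0.
  rewrite -(real_normK (num_real (qform H x))).
  by apply: lerXn2r; rewrite ?nnegrE ?mulr_ge0// qform_bound.
have up := energy_upper HL a0 hH (rsummableZ _ sg) hg; rewrite -/m rsumZ// in up.
have := ler_norm (- \tr H); rewrite normrN => t1.
have := ler_norm (\tr H) => t2.
have am0 : 0 <= a * m by rewrite mulr_ge0// ltW.
have u1 := ler_wpM2l am0 t1; have u2 := ler_wpM2l am0 t2.
have sS : 0 <= a ^+ 2 * n.+1%:R ^+ 2 * e ^+ 2 * rsum (L `\ 0) g.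
  by rewrite !mulr_ge0// ltW.
rewrite /K ler_norml; apply/andP; split; lra.
Qed.

Lemma mx_norm_coord H i j : `|H i j| <= `|H|.
Proof.
have -> : `|H| = mx_norm H by [].
by rewrite mx_normrE (le_bigmax _ (fun ij => `|H ij.1 ij.2|) (i, j)).
Qed.

(** A differentiable curve satisfies [|c h - Y0| <= B |h|] near 0, so the difference quotient of [F]
    along it is at most [K B^2 |h|]. *)
Lemma critical_of_quadratic_bound (F : 'M[R]_n.+1 -> R) (M : set 'M[R]_n.+1) Y0 (K d : R) :
  M Y0 -> 0 < d -> 0 <= K ->
  (forall H, M (Y0 + H) -> `|H| <= d -> `|F (Y0 + H) - F Y0| <= K * `|H| ^+ 2) ->
  critical_on M F Y0.
Proof.
move=> MY0 d0 K0 hF; split=> // c c0 Mc dc.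
pose v := 'D_1 c 0.
have cv : h^-1 *: ((c \o shift 0) (h *: (1 : R)) - c 0) @[h --> (0:R)^'] --> v by exact: dc.
pose B := `|v| + 1.
have B0 : 0 < B by rewrite ltr_wpDl.
have nB : \forall h \near (0:R)^', `|h^-1 *: ((c \o shift 0) (h *: (1 : R)) - c 0)| <= B.
  by apply: (cvgr_norm_le v cv); rewrite ltrDl.
have lim0 : h^-1 *: (((F \o c) \o shift 0) (h *: (1 : R)) - (F \o c) 0)
    @[h --> (0:R)^'] --> (0 : R).
  apply/cvgrPdist_le => eps eps0.
  have KB : 0 <= K * B ^+ 2 by rewrite mulr_ge0 ?sqr_ge0.
  (* The first bound keeps the curve within distance [d], the second makes [K B^2 |h|] at most
     [eps]; the added 1 covers [K = 0]. *)
  pose r := Num.min (d / B) (eps / (K * B ^+ 2 + 1)).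
  have r0 : 0 < r by rewrite lt_min !divr_gt0// ltr_wpDl.
  have nM : \forall h \near (0:R)^', M (c h) by exact: nbhs_dnbhs.
  near=> h.
  have h0 : h != 0 by near: h; exact: nbhs_dnbhs_neq.
  have hr : `|h| <= r by near: h; exact: dnbhs0_le.
  have hM : M (c h) by near: h.
  have : `|h^-1 *: ((c \o shift 0) (h *: (1 : R)) - c 0)| <= B by near: h.
  rewrite /= addr0 c0 -[h *: 1]/(h * 1) mulr1 normrZ normfV ler_pdivrMl ?normr_gt0// => hB.
  move: hr; rewrite le_min => /andP[hd he].
  have := hF (c h - Y0); rewrite addrC subrK => /(_ hM) hFh.
  rewrite sub0r normrN normrM normfV ler_pdivrMl ?normr_gt0//.
  apply: le_trans (hFh _) _.
    apply: le_trans hB _; by rewrite -ler_pdivlMr.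
  have hB2 : `|c h - Y0| ^+ 2 <= (`|h| * B) ^+ 2.
    by apply: lerXn2r; rewrite ?nnegrE// mulr_ge0// ltW.
  apply: le_trans (ler_wpM2l K0 hB2) _.
  rewrite (_ : K * _ = `|h| * (`|h| * (K * B ^+ 2))); last by ring.
  rewrite ler_wpM2l//; move: he; rewrite ler_pdivlMr ?ltr_wpDl//.
  have := normr_ge0 h; nra.
apply: DeriveDef; first by apply: cvgP lim0.
exact: cvg_lim lim0.
Unshelve. all: by end_near.
Qed.

Lemma near_mx_entries Y0 (P : set 'M[R]_n.+1) : (\forall Y \near Y0, P Y) ->
  exists2 r : R, 0 < r & forall H, (forall i j, `|H i j| < r) -> P (Y0 + H).
Proof.
move=> /nbhs_ballP[r /= r0 rP]; exists r => // H Hr; apply: rP; split=> // i j.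
by rewrite -ball_normE /= mxE opprD addrA subrr sub0r normrN.
Qed.

Lemma near_of_mx_entries Y0 (P : set 'M[R]_n.+1) (r : R) : 0 < r ->
  (forall H, (forall i j, `|H i j| < r) -> P (Y0 + H)) -> \forall Y \near Y0, P Y.
Proof.
move=> r0 rP; apply/nbhs_ballP; exists r => //= Y [_ YB].
rewrite -[Y](subrK Y0) addrC; apply: rP => i j.
by have := YB i j; rewrite -ball_normE /= !mxE distrC.
Qed.

End Critical.

(** * Local extrema *)

Section Root.
Context {R : realType} {n : nat}.

Definition root_vec (i j : 'I_n) (s : bool) : 'cV[R]_n :=
  delta_mx i 0 + (-1) ^+ s *: delta_mx j 0.

Lemma qform_root_vec (H : 'M[R]_n) i j s :
  qform H (root_vec i j s) = H i i + H j j + (-1) ^+ s * (H i j + H j i).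
Proof.
have bil (k l : 'I_n) : (delta_mx 0 k *m H *m delta_mx l 0 : 'M[R]_1) 0 0 = H k l.
  by rewrite -rowE -colE !mxE.
have rT : (root_vec i j s)^T = delta_mx 0 i + (-1) ^+ s *: delta_mx 0 j.
  by rewrite linearD linearZ /= !trmx_delta.
rewrite /qform rT !mulmxDl !mulmxDr -!scalemxAl -!scalemxAr.
rewrite scalerA -signr_addb addbb expr0 scale1r !mxE.
have mE (u v : 'M[R]_1) : (u + v) 0 0 = u 0 0 + v 0 0 by rewrite mxE.
have := bil i i; have := bil j j; have := bil i j; have := bil j i.
rewrite !mxE => -> -> -> ->; ring.
Qed.

Lemma normsq_root_vec i j s : i != j -> normsq (root_vec i j s) = 2.
Proof.
move=> ij; have ji : (j == i) = false by rewrite eq_sym (negbTE ij).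
by rewrite -qform1 qform_root_vec !mxE !eqxx (negbTE ij) ji addr0 mulr0 addr0.
Qed.

Lemma root_vec_even_lattice i j s : even_lattice (root_vec i j s).
Proof.
by have := @even_lattice_signed_pair R n i j false s; rewrite expr0 scale1r.
Qed.

(* This is the perfection of the root system D_n. *)
Lemma root_values_bound (H : 'M[R]_n) (T : R) : (2 < n)%N -> H^T = H ->
  (forall i j s, i != j -> qform H (root_vec i j s) ^+ 2 <= T) ->
  forall i j, H i j ^+ 2 <= 9 / 4 * T.
Proof.
move=> n2 sH hT.
have T0 : 0 <= T.
  have i := Ordinal (leq_ltn_trans (leq0n 2) n2).
  have [k /andP[ki _]] := exists_third i i n2.
  by apply: le_trans (hT k i false ki); exact: sqr_ge0.
have Hs i j : H j i = H i j by rewrite -{1}sH mxE.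
(* Averaging over the two signs gives [(H i i + H j j)^2 + 4 (H i j)^2 <= T], which also bounds the
   off-diagonal entries. *)
have diag i j : i != j -> (H i i + H j j) ^+ 2 <= T.
  move=> ij; have := hT i j false ij; have := hT i j true ij.
  rewrite !qform_root_vec (Hs i j) /= expr0 expr1.
  move: (H i i) (H j j) (H i j) => u v w; have := sqr_ge0 w; lra.
move=> i j; have [->|ij] := eqVneq i j; last first.
  have := hT i j false ij; have := hT i j true ij; have := T0.
  rewrite !qform_root_vec (Hs i j) /= expr0 expr1.
  move: (H i i) (H j j) (H i j) => u v w.
  have := sqr_ge0 (u + v); lra.
have [k /andP[kj _]] := exists_third j j n2.
have [l /andP[lj lk]] := exists_third j k n2.
have := diag k j kj; have := diag l j lj; have := diag l k lk.
move: (H j j) (H k k) (H l l) => u v w h1 h2 h3.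
(* [2 u = A + B - C], and the three squares below express [(A + B - C)^2 <= 3 (A^2 + B^2 + C^2) <= 9
   T]. *)
pose A := v + u; pose B := w + u; pose C := w + v.
have := sqr_ge0 (A - B); have := sqr_ge0 (A + C); have := sqr_ge0 (B + C).
by rewrite /A /B /C; lra.
Qed.

End Root.

(** * Shears as explicit curves of unimodular forms through the identity *)

Section Shear.
Context {R : realType} {n : nat}.
Implicit Types (i j : 'I_n) (t : R).

(* [1 + shear i j t] is [P^T *m P] for the unipotent matrix [P = 1 + t E_ji]. *)
Definition shear i j t : 'M[R]_n :=
  t *: delta_mx j i + t *: delta_mx i j + t ^+ 2 *: delta_mx i i.

Lemma shear_unimodular i j t : (i < j)%N -> unimodular_forms R n (1%:M + shear i j t).
Proof.
move=> ij; pose P : 'M[R]_n := 1%:M + t *: delta_mx j i.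
have PE : 1%:M + shear i j t = P^T *m P.
  have -> : P^T = 1%:M + t *: delta_mx i j.
    by rewrite /P linearD linearZ /= trmx1 trmx_delta.
  rewrite /P mulmxDl !mulmxDr !mul1mx !mulmx1.
  rewrite -scalemxAl -scalemxAr mul_delta_mx scalerA -expr2 /shear.
  by rewrite !addrA.
have dP : \det P = 1.
  have trigP : is_trig_mx P.
    apply/is_trig_mxP => k l kl; rewrite !mxE.
    have -> : (k == l) = false by apply/negbTE; rewrite -val_eqE /= ltn_eqF.
    case: eqP => [kj|]; case: eqP => [li|] /=; rewrite ?mulr0 ?addr0//.
    by move: kl; rewrite kj li; lia.
  rewrite det_trig// big1// => k _; rewrite !mxE eqxx.
  case: eqP => [->|]; case: eqP => [ji|] /=; rewrite ?mulr0 ?addr0//.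
  by move: ij; rewrite ji ltnn.
split.
- by rewrite PE trmx_mul trmxK.
- move=> x x0; rewrite PE mulmxA -trmx_mul -mulmxA.
  rewrite (_ : (_ *m _) 0 0 = normsq (P *m x)); last first.
    by rewrite mxE; apply: eq_bigr => k _; rewrite mxE.
  rewrite lt_def normsq_ge0 andbT; apply: contraNneq x0 => /normsq_eq0 Px.
  have uP : P \in unitmx by rewrite unitmxE dP unitr1.
  by rewrite -[x](mulKmx uP) Px mulmx0.
by rewrite PE det_mulmx det_tr dP mulr1.
Qed.

Lemma shear_entries i j t : (i < j)%N -> 0 <= t <= 1 ->
  forall k l, `|shear i j t k l| <= t.
Proof.
move=> ij /andP[t0 t1] k l; rewrite !mxE.
have t2 : t ^+ 2 <= t by rewrite expr2 ler_piMl.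
have ji : (j == i) = false by apply/negbTE; rewrite -val_eqE /= gtn_eqF.
have ij' : (i == j) = false by rewrite eq_sym.
case: (eqVneq k j) => [->|kj]; rewrite ?ji ?andbF /=.
  by case: (l == i); rewrite ?mulr1 !mulr0 !addr0 ?normr0// ger0_norm.
case: (eqVneq k i) => [_|ki] /=; last by rewrite !mulr0 !addr0 normr0.
case: (eqVneq l j) => [->|lj]; rewrite ?ji /=.
  by rewrite !mulr0 add0r addr0 mulr1 ger0_norm.
by case: (l == i); rewrite ?mulr1 !mulr0 !add0r ?normr0// ger0_norm// sqr_ge0.
Qed.

(** The trace is positive, so the linear term of the energy decreases along a shear, at order
    [t^2]. *)
Lemma tr_shear i j t : (i < j)%N -> \tr (shear i j t) = t ^+ 2.
Proof.
move=> ij; have ji : (j == i) = false by apply/negbTE; rewrite -val_eqE /= gtn_eqF.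
have td (k l : 'I_n) : \tr (delta_mx k l : 'M[R]_n) = (k == l)%:R.
  rewrite /mxtrace (bigD1 k)//= big1 => [|m mk]; first by rewrite mxE eqxx addr0.
  by rewrite mxE (negbTE mk).
by rewrite /shear !mxtraceD !mxtraceZ !td ji eq_sym ji eqxx !mulr0 !add0r mulr1.
Qed.

(** Where [x i * x j = 0] the form is only of order [t^2], and its square of order [t^4]. *)
Lemma qform_shear i j t x :
  qform (shear i j t) x = 2 * t * (x i 0 * x j 0) + t ^+ 2 * x i 0 ^+ 2.
Proof.
have qd (b : R) (k l : 'I_n) : qform (b *: delta_mx k l) x = b * (x k 0 * x l 0).
  rewrite qformE (bigD1 k)//= [X in _ + X]big1 => [|m mk]; last first.
    by rewrite big1// => p _; rewrite !mxE (negbTE mk) mulr0 mul0r.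
  rewrite (bigD1 l)//= big1 => [|m ml]; first by rewrite !mxE !eqxx mulr1 !addr0.
  by rewrite !mxE (negbTE ml) andbF mulr0 mul0r.
rewrite /shear !qformD !qd; ring.
Qed.

End Shear.

(** * Critical points, minima and maxima for large [a] *)

Section Extrema.
Context {R : realType} {n : nat}.
Implicit Types (L : set 'cV[R]_n.+1) (H Y : 'M[R]_n.+1) (a : R).

Lemma unimodular_forms1 : unimodular_forms R n.+1 1%:M.
Proof.
split; [by rewrite trmx1| |by rewrite det1].
move=> x x0; rewrite -/(qform 1%:M x) qform1 lt_def normsq_ge0 andbT.
by apply: contraNneq x0 => /normsq_eq0 ->.
Qed.

Lemma sym_lattice_critical L a y : sym_lattice L -> L y -> normsq y = 2 -> 0 < a ->
  critical_on (unimodular_forms R n.+1) (energy (gauss a) L) 1%:M.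
Proof.
move=> HL Ly y2 a0.
have [K [d [K0 d0 hK]]] := energy_quadratic_bound HL a0 Ly y2.
apply: (critical_of_quadratic_bound (K := K) (d := d)) => //.
  exact: unimodular_forms1.
move=> H [_ _ dH] Hd; apply: hK => //; exact: mx_norm_coord.
Qed.

Lemma Dn_plus_local_min : ~~ odd n.+1 -> (8 <= n.+1)%N ->
  exists2 a0 : R, 0 < a0 & forall a, a0 <= a ->
    lattice_local_min (gauss a) (Dn_plus R n.+1).
Proof.
move=> on n8; have HL := @Dn_plus_sym R _ on n8.
set L := Dn_plus R n.+1.
have [C C0 trC] := @tr_bound_det1 R n.+1.
pose C1 := expR 2 * moment L 1. have n0 : 0 < n.+1%:R :> R by rewrite ltr0n.
have C10 : 0 <= C1 by rewrite mulr_ge0 ?expR_ge0// moment_ge0.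
have CC0 : 0 <= 9 * C1 * C by rewrite mulr_ge0// mulr_ge0.
exists (1 + 9 * C1 * C); first by rewrite ltr_pwDl.
move=> a ha; have a1 : 1 <= a.
  by apply: le_trans ha; rewrite lerDl.
have a0 : 0 < a by lra.
split; first exact: unimodular_forms1.
have n1 : 1 <= n.+1%:R :> R by rewrite ler1n.
pose d := Num.min 1 (Num.min (8^-1 / n.+1%:R) (2^-1 / a / n.+1%:R)).
have d0 : 0 < d by rewrite !lt_min ltr01 !divr_gt0 ?invr_gt0.
apply: (near_of_mx_entries d0) => H Hd [sY _ dY].
have sH : H^T = H.
  by move: sY; rewrite linearD /= trmx1 => /addrI.
(* [e] is the largest absolute value of an entry of [H], attained at [p], so bounding that one entry
   bounds [e]. *)
have [p _ hp] := arg_maxP (fun p : 'I_n.+1 * 'I_n.+1 => `|H p.1 p.2|) (erefl : predT (0, 0)).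
set e := `|H p.1 p.2| in hp.
have He i j : `|H i j| <= e by apply: (hp (i, j)).
have e0 : 0 <= e by exact: normr_ge0.
have : e < d by exact: Hd.
rewrite !lt_min => /and3P[/ltW e1 /ltW e8 /ltW ea].
have ne8 : n.+1%:R * e <= 8^-1 by rewrite mulrC -ler_pdivlMr// (lt_le_trans ltr01).
have hH := qform_small He ne8.
rewrite -subr_ge0; set D := (X in 0 <= X).
pose m := moment L a; have m0 : 0 <= m := moment_ge0 HL a0.
have mC : m <= expR (- a * 2) * C1 by exact: moment_le.
pose w := a ^+ 2 / 4 * expR (- a * 2).
have w0 : 0 < w by rewrite mulr_gt0 ?expR_gt0// divr_gt0// exprn_gt0.
(* With this [T], [energy_lower] says that every root has [h^2 <= T]. Perfection then gives
   [e^2 <= 9/4 T], hence [|tr H| <= C (9/4 T)], and [D] is at least [a exp (- 2 a) T / 4] times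
   [a - 9 C1 C], which explains the threshold. *)
pose T := (D + a * (m * \tr H)) / w.
have hT i j s : i != j -> qform H (root_vec i j s) ^+ 2 <= T.
  move=> ij; have y2 := @normsq_root_vec R _ i j s ij.
  have Ly : L (root_vec i j s) by rewrite /L Dn_plusE; exact: root_vec_even_lattice.
  have ay : a * `|qform H (root_vec i j s)| <= 1.
    have := qform_bound (root_vec i j s) He; rewrite y2 => h.
    have : e * n.+1%:R * a <= 2^-1 by rewrite -!ler_pdivlMr// ?(lt_le_trans ltr01)// mulrAC.
    have := ler_wpM2l (ltW a0) h; lra.
  have := energy_lower HL a0 hH Ly y2 ay.
  rewrite ler_pdivlMr// -/m -/w mulrC /D; lra.
have eT : e ^+ 2 <= 9 / 4 * T.
  rewrite (real_normK (num_real _)); apply: root_values_bound => //.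
  exact: leq_trans n8.
have T0 : 0 <= T by have := sqr_ge0 e; lra.
have tr : `|\tr H| <= C * (9 / 4 * T).
  by apply: le_trans (trC H e e1 He dY) _; rewrite ler_wpM2l.
have mtr : a * (m * \tr H) <= a * (expR (- a * 2) * C1 * (C * (9 / 4 * T))).
  rewrite ler_wpM2l ?(ltW a0)//; apply: le_trans (ler_wpM2l m0 (ler_norm _)) _.
  by apply: ler_pM.
have DE : D = w * T - a * (m * \tr H) by rewrite /T; field; lra.
have : 0 <= a * (expR (- a * 2) * T) * (a - 9 * C1 * C).
  apply: mulr_ge0; last by lra.
  by rewrite mulr_ge0 ?(ltW a0)// mulr_ge0 ?expR_ge0.
rewrite DE /w; lra.
Qed.

(** Along the shear [h y >= 2 t], so the root gains at least [a^2 exp (- 2 a) t^2], while the linear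
    term loses at most [a C1 exp (- 2 a) t^2]. The gain wins once [a > C1]. *)
Lemma not_local_max_of_root L (i j : 'I_n.+1) y : sym_lattice L -> (i < j)%N ->
  L y -> normsq y = 2 -> y i 0 * y j 0 = 1 ->
  exists2 a0 : R, 0 < a0 & forall a, a0 <= a ->
    ~ local_max_on (unimodular_forms R n.+1) (energy (gauss a) L) 1%:M.
Proof.
move=> HL ij Ly y2 yij.
pose C1 := expR 2 * moment L 1.
have C10 : 0 <= C1 by rewrite mulr_ge0 ?expR_ge0// moment_ge0.
exists (1 + C1); first by rewrite ltr_pwDl.
move=> a ha [_ /near_mx_entries[r r0 hr]].
have a1 : 1 <= a by lra.
have a0 : 0 < a by lra.
have n1 : 0 < n.+1%:R :> R by rewrite ltr0n.
(* [r / 2] puts the shear strictly inside the neighbourhood; the last two bounds are the hypotheses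
   of [energy_lower]. *)
pose t := Num.min 1 (Num.min (r / 2) (Num.min (8^-1 / n.+1%:R) (2^-1 / a / n.+1%:R))).
have t0 : 0 < t by rewrite !lt_min ltr01 !divr_gt0 ?invr_gt0.
have : t <= t by []. 
rewrite {2}/t !le_min => /and4P[t1 tr t8 ta].
have tI : 0 <= t <= 1 by rewrite t1 ltW.
have He := shear_entries ij tI.
have ne8 : n.+1%:R * t <= 8^-1 by rewrite mulrC -ler_pdivlMr.
have hH := qform_small He ne8.
have ay : a * `|qform (shear i j t) y| <= 1.
  have := qform_bound y He; rewrite y2 => h.
  have : t * n.+1%:R * a <= 2^-1 by rewrite -!ler_pdivlMr// mulrAC.
  have := ler_wpM2l (ltW a0) h; lra.
have := energy_lower HL a0 hH Ly y2 ay.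
have : energy (gauss a) L (1%:M + shear i j t) <= energy (gauss a) L 1%:M.
  apply: hr; last exact: shear_unimodular.
  by move=> k l; apply: le_lt_trans (He k l) _; apply: le_lt_trans tr _; lra.
rewrite tr_shear// qform_shear yij.
have mC : moment L a <= expR (- a * 2) * C1 by exact: moment_le.
set q := 2 * t * 1 + _.
have q2 : 4 * t ^+ 2 <= q ^+ 2.
  have : 2 * t <= q by rewrite /q mulr1 lerDl mulr_ge0 ?sqr_ge0.
  have -> : 4 * t ^+ 2 = (2 * t) ^+ 2 by ring.
  by move=> h; apply: lerXn2r; rewrite ?nnegrE//; [lra|apply: le_trans h; lra].
set E1 := energy _ _ _; set E2 := energy _ _ _ => h1 h2.
have w0 := expR_gt0 (- a * 2).
have t20 : 0 < t ^+ 2 by rewrite exprn_gt0.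
have : a * (moment L a * t ^+ 2) <= a * (expR (- a * 2) * C1 * t ^+ 2).
  by rewrite ler_wpM2l ?(ltW a0)// ler_wpM2r ?(ltW t20).
have : a ^+ 2 / 4 * expR (- a * 2) * (4 * t ^+ 2) <= a ^+ 2 / 4 * expR (- a * 2) * q ^+ 2.
  by rewrite ler_wpM2l// mulr_ge0 ?(ltW w0)// divr_ge0// sqr_ge0.
have : 0 < a * (expR (- a * 2) * t ^+ 2) * (a - C1).
  apply: mulr_gt0; last by lra.
  by rewrite mulr_gt0// mulr_gt0.
lra.
Qed.

(** The linear term lowers the energy by at least [a exp (- 2 a) t^2]; coordinate 0 of [y] enters
    because [moment] is read off there. The remainder is at most [a^2 t^2 exp (- 3 a) B], and
    [a B < a^2 / 4 <= exp a] once [a > 4 B]. *)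
Lemma not_local_min_of_flat_direction L (i j : 'I_n.+1) y : sym_lattice L -> (i < j)%N ->
  L y -> normsq y = 2 -> y 0 0 ^+ 2 = 1 ->
  (forall x, L x -> x i 0 * x j 0 = 0 \/ 4 <= normsq x) ->
  exists2 a0 : R, 0 < a0 & forall a, a0 <= a ->
    ~ local_min_on (unimodular_forms R n.+1) (energy (gauss a) L) 1%:M.
Proof.
move=> HL ij Ly y2 y0 cross.
pose g (x : 'cV[R]_n.+1) := normsq x ^+ 2 * expR (- 1 * normsq x) : R.
have g0 x : 0 <= g x by rewrite /g mulr_ge0 ?expR_ge0 ?sqr_ge0.
have sg : rsummable (L `\ 0) g.
  apply: (@rsummable_poly_gauss _ _ _ HL 1 1); first lra.
  move=> x _; rewrite ger0_norm// mul1r /g.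
  by rewrite ler_wpM2r ?expR_ge0// lerDr.
pose S := rsum (L `\ 0) g.
have S0 : 0 <= S by apply: rsum_ge0.
pose B := (1 + 4 * expR 4) * S.
have B0 : 0 <= B by rewrite mulr_ge0// addr_ge0// mulr_ge0// expR_ge0.
exists (2 + 4 * B); first by rewrite ltr_pwDl// mulr_ge0.
move=> a ha [_ /near_mx_entries[r r0 hr]].
have a2 : 2 <= a by lra.
have a0 : 0 < a by lra.
have n1 : 0 < n.+1%:R :> R by rewrite ltr0n.
(* The bound [exp (- 3 a)] makes the [t^4] terms of the flat vectors negligible against
   [exp (- 2 a) t^2]. *)
pose t := Num.min 1 (Num.min (r / 2) (Num.min (8^-1 / n.+1%:R) (expR (- a * 3)))).
have t0 : 0 < t by rewrite !lt_min ltr01 !divr_gt0 ?invr_gt0// expR_gt0.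
have : t <= t by [].
rewrite {2}/t !le_min => /and4P[t1 tr t8 ta].
have tI : 0 <= t <= 1 by rewrite t1 ltW.
have He := shear_entries ij tI.
have ne8 : n.+1%:R * t <= 8^-1 by rewrite mulrC -ler_pdivlMr.
have hH := qform_small He ne8.
have t2 : t ^+ 2 <= expR (- a * 3).
  by apply: le_trans ta; rewrite expr2 ler_piMl// ltW.
(* The summand [t^2] serves the vectors with [x i * x j = 0]. The other serves those of norm
   [N >= 4], where [h^2 <= (2 t N)^2] and [exp (- 7 a N / 8) <= exp 4 * exp (- 7 a / 2) * exp (-
   N)]. *)
pose k := a ^+ 2 * t ^+ 2 * (t ^+ 2 + 4 * (expR 4 * expR (- a * (7 / 2)))).
have hg x : (L `\ 0) x ->
    a ^+ 2 * qform (shear i j t) x ^+ 2 * expR (a * `|qform (shear i j t) x|) * wt a x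
    <= k * g x.
  move=> [Lx /eqP x0]; have N0 := normsq_ge0 x; have N2 := sym_min_norm HL Lx x0.
  set N := normsq x in N0 N2 *.
  have xiN : x i 0 ^+ 2 <= N := sqr_coord_le x i.
  have G0 : 0 <= N ^+ 2 * expR (- 1 * N) := g0 x.
  have at0 : 0 <= a ^+ 2 * t ^+ 2 by rewrite mulr_ge0 ?sqr_ge0.
  have ew : expR (a * `|qform (shear i j t) x|) * wt a x <= expR (- (7 / 8 * a) * N).
    rewrite /wt -expRD ler_expR.
    have := ler_wpM2l (ltW a0) (hH x); rewrite -/N; lra.
  rewrite -[leLHS]mulrA; apply: (@le_trans _ _
    (a ^+ 2 * qform (shear i j t) x ^+ 2 * expR (- (7 / 8 * a) * N))).
    by rewrite ler_wpM2l// mulr_ge0 ?sqr_ge0.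
  have [xij|N4] := cross x Lx.
    have q2 : qform (shear i j t) x ^+ 2 <= t ^+ 2 * t ^+ 2 * N ^+ 2.
      rewrite qform_shear xij mulr0 add0r (_ : _ * N ^+ 2 = (t ^+ 2 * N) ^+ 2); last by ring.
      by apply: lerXn2r; rewrite ?nnegrE ?ler_wpM2l ?sqr_ge0// mulr_ge0 ?sqr_ge0.
    apply: (@le_trans _ _ (a ^+ 2 * (t ^+ 2 * t ^+ 2 * N ^+ 2) * expR (- 1 * N))).
      apply: ler_pM; [by rewrite mulr_ge0 ?sqr_ge0|exact: expR_ge0| |].
        by rewrite ler_wpM2l ?sqr_ge0.
      rewrite ler_expR; have : 0 <= (7 / 8 * a - 1) * N by rewrite mulr_ge0//; lra.
      lra.
    rewrite /k /g -/N.
    have : 0 <= a ^+ 2 * t ^+ 2 * (4 * (expR 4 * expR (- a * (7 / 2)))) * (N ^+ 2 * expR (- 1 * N)).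
      by apply: mulr_ge0 => //; apply: mulr_ge0 => //; rewrite mulr_ge0// mulr_ge0 ?expR_ge0.
    lra.
  have q2 : qform (shear i j t) x ^+ 2 <= 4 * t ^+ 2 * N ^+ 2.
    have -> : 4 * t ^+ 2 * N ^+ 2 = (2 * t * N) ^+ 2 by ring.
    rewrite -(real_normK (num_real (qform _ _))); apply: lerXn2r; rewrite ?nnegrE//.
      by rewrite mulr_ge0// mulr_ge0// ltW.
    have xij : `|x i 0 * x j 0| <= N / 2.
      have : x i 0 ^+ 2 + x j 0 ^+ 2 <= N.
        rewrite /N /normsq (bigD1 i)//= (bigD1 j)/=; last first.
          by apply/negP => /eqP ji; move: ij; rewrite ji ltnn.
        by rewrite addrA lerDl sumr_ge0// => l _; exact: sqr_ge0.
      have := sqr_ge0 (x i 0 - x j 0); have := sqr_ge0 (x i 0 + x j 0).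
      by move=> h1 h2 h3; rewrite ler_norml; apply/andP; split; lra.
    rewrite qform_shear; apply: le_trans (ler_normD _ _) _.
    rewrite normrM (ger0_norm (x := 2 * t)); last by rewrite mulr_ge0// ltW.
    rewrite (ger0_norm (x := t ^+ 2 * _)); last by rewrite mulr_ge0 ?sqr_ge0.
    have h1 : 2 * t * `|x i 0 * x j 0| <= 2 * t * (N / 2).
      by rewrite ler_wpM2l// mulr_ge0// ltW.
    have h2 : t ^+ 2 * x i 0 ^+ 2 <= t * N.
      by apply: ler_pM; rewrite ?sqr_ge0// expr2 ler_piMl// ltW.
    lra.
  rewrite -/N in N4.
  apply: (@le_trans _ _ (a ^+ 2 * (4 * t ^+ 2 * N ^+ 2) *
      (expR 4 * expR (- a * (7 / 2)) * expR (- 1 * N)))).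
    apply: ler_pM; [by rewrite mulr_ge0 ?sqr_ge0|exact: expR_ge0| |].
      by rewrite ler_wpM2l ?sqr_ge0.
    rewrite -!expRD ler_expR.
    have : 0 <= (7 / 8 * a - 1) * (N - 4) by rewrite mulr_ge0//; lra.
    lra.
  rewrite /k /g -/N.
  have : 0 <= a ^+ 2 * t ^+ 2 * t ^+ 2 * (N ^+ 2 * expR (- 1 * N)).
    by apply: mulr_ge0 => //; apply: mulr_ge0 => //; exact: sqr_ge0.
  lra.
have := energy_upper HL a0 hH (rsummableZ _ sg) hg; rewrite rsumZ// -/S tr_shear//.
have : energy (gauss a) L 1%:M <= energy (gauss a) L (1%:M + shear i j t).
  apply: hr; last exact: shear_unimodular.
  by move=> p q; apply: le_lt_trans (He p q) _; apply: le_lt_trans tr _; lra.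
set E1 := energy _ _ _; set E2 := energy _ _ _ => h1 h2.
have mlow : expR (- a * 2) <= moment L a.
  by have := moment_ge HL a0 Ly y2; rewrite y0 mulr1.
have t20 : 0 < t ^+ 2 by rewrite exprn_gt0.
have h3 : a * (expR (- a * 2) * t ^+ 2) <= a * (moment L a * t ^+ 2).
  by rewrite ler_wpM2l ?(ltW a0)// ler_wpM2r ?(ltW t20).
have kS : k * S <= a ^+ 2 * t ^+ 2 * (expR (- a * 3) * B).
  rewrite /k -[leLHS]mulrA; apply: ler_wpM2l; first by rewrite mulr_ge0 ?sqr_ge0.
  rewrite /B [leRHS]mulrA; apply: ler_wpM2r => //.
  have : expR (- a * (7 / 2)) <= expR (- a * 3) by rewrite ler_expR; lra.
  move=> h; have := ler_wpM2l (expR_ge0 4) h; lra.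
have ea : a * B < expR a.
  apply: (@lt_le_trans _ _ (a ^+ 2 / 4)); last first.
    by apply: le_trans (expR_ge_quad _); lra.
  have : 0 < a * (a - 4 * B) by rewrite mulr_gt0//; lra.
  lra.
have e3 : expR (- a * 3) * expR a = expR (- a * 2) by rewrite -expRD; congr expR; ring.
have e30 := expR_gt0 (- a * 3).
have : 0 < a * t ^+ 2 * (expR (- a * 3) * (expR a - a * B)).
  by rewrite mulr_gt0 ?mulr_gt0// subr_gt0.
rewrite mulrBr e3.
lra.
Qed.

End Extrema.

(** * The saddle point at the sum of two copies of E_8 *)

Section E8E8.
Context {R : realType}.

Lemma E8_root_vec i j s : i != j -> E8 R (root_vec i j s).
Proof.
by move=> ij; apply: span_gen; left; exists i, j, false, s; rewrite expr0 scale1r.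
Qed.

(** A nonzero product needs nonzero components in both blocks, each of norm at least 2. *)
Lemma E8E8_cross (x : 'cV[R]_(8 + 8)) i j : orthosum (E8 R) (E8 R) x ->
  x (lshift 8 i) 0 * x (rshift 8 j) 0 = 0 \/ 4 <= normsq x.
Proof.
move=> /orthosumP[xu xd].
have [u0|u0] := eqVneq (usubmx x) 0.
  by left; have := congr1 (fun v : 'cV_8 => v i 0) u0; rewrite /= !mxE => ->; rewrite mul0r.
have [d0|d0] := eqVneq (dsubmx x) 0.
  by left; have := congr1 (fun v : 'cV_8 => v j 0) d0; rewrite /= !mxE => ->; rewrite mulr0.
right; rewrite normsq_block.
have := sym_min_norm E8_sym xu u0; have := sym_min_norm E8_sym xd d0; lra.
Qed.

(** A root whose coordinates 0 and 1 both equal 1: it serves the shear inside the first block and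
    also bounds [moment] from below. *)
Definition e01 : 'cV[R]_(8 + 8) := col_mx (root_vec 0 1 false) 0.

Lemma e01_mem : orthosum (E8 R) (E8 R) e01.
Proof. by apply/orthosumP; rewrite col_mxKu col_mxKd; split; [exact: E8_root_vec|exact: span0]. Qed.

Lemma normsq_e01 : normsq e01 = 2.
Proof.
rewrite normsq_col_mx normsq_root_vec// /normsq big1 ?addr0// => i _.
by rewrite mxE expr0n.
Qed.

Lemma E8E8_saddle : exists2 a0 : R, 0 < a0 & forall a, a0 <= a ->
  @lattice_saddle R 15 (gauss a) (orthosum (E8 R) (E8 R)).
Proof.
pose L : set 'cV[R]_16 := orthosum (E8 R) (E8 R).
have HL : sym_lattice L := E8E8_sym.
have l0 : (0 : 'I_16) = lshift 8 (0 : 'I_8) by exact: val_inj.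
have y00 : (e01 : 'cV[R]_16) 0 0 = 1.
  by rewrite l0 [LHS]col_mxEu !mxE /= mulr0 addr0.
have y11 : (e01 : 'cV[R]_16) (lshift 8 (1 : 'I_8)) 0 = 1.
  by rewrite [LHS]col_mxEu !mxE /= expr0 mul1r add0r.
have [a1 a10 h1] := @not_local_max_of_root R 15 L 0 (lshift 8 (1 : 'I_8)) e01 HL isT
  e01_mem normsq_e01 (etrans (congr2 *%R y00 y11) (mulr1 1)).
(* This shear couples the first coordinates of the two blocks, a pair on which no root is nonzero at
   both places. *)
have [a2 a20 h2] := @not_local_min_of_flat_direction R 15 L 0 (rshift 8 (0 : 'I_8)) e01 HL isT
  e01_mem normsq_e01 (etrans (congr1 (fun u => u ^+ 2) y00) (expr1n _ _))
  (fun x Lx => eq_ind_r (fun k => x k 0 * _ = 0 \/ _) (E8E8_cross 0 0 Lx) l0).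
exists (a1 + a2); first lra.
move=> a ha; split.
- by apply: (sym_lattice_critical HL e01_mem normsq_e01); lra.
- by apply: h2; lra.
- by apply: h1; lra.
Qed.

End E8E8.

Theorem mainTheorem2 (R : realType) :
  exists alpha0 : R, 0 < alpha0 /\
    forall alpha : R, alpha0 <= alpha ->
      lattice_local_min (gauss alpha) (Dn_plus R 16) /\
      lattice_saddle (gauss alpha) (orthosum (E8 R) (E8 R)).
Proof.
have [a1 a10 h1] := @Dn_plus_local_min R 15 isT isT.
have [a2 a20 h2] := @E8E8_saddle R.
exists (a1 + a2); split; first lra.
by move=> a ha; split; [apply: h1; lra|apply: h2; lra].
Qed.
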